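(* Let $P^n$ be a simple polytope with $m$ facets and let $\lambda$ be a characteristic function on $P^n$. Let $K_1,\dots,K_m$ be simplicial complexes on $j_1,\dots,j_m$ vertices respectively, and put $X_i=Z(K_i)=Z(K_i;(D^2,S^1))$, with $S^1$ acting on $X_i$ through the diagonal $S^1\to T^{j_i}$; assume these circle actions are free. Then the group $\ker\lambda\subset T^m$ acts freely on the moment-angle complex $Z\big(K_P(K_1,\dots,K_m);(D^2,S^1)\big)$ and the space $\big((X_1\times\cdots\times X_m)/\ker\lambda\big)\times P^n/\!\sim_2$ corresponds, up to homotopy, to the quotient by this action, as follows: $$\begin{aligned} \big((X_1\times\cdots\times X_m)/\ker\lambda\big)\times P^n/\!\sim_2\ &\cong\ Z\big(K_P;(\underline{CZ(K_i)},\underline{Z(K_i)})\big)/\ker\lambda\\ &\simeq\ Z\big(K_P;(\underline{(D^2)^{j_i}},\underline{Z(K_i)})\big)/\ker\lambda\\ &\cong\ Z\big(K_P(K_1,K_2,\dots,K_m);(D^2,S^1)\big)/\ker\lambda , \end{aligned}$$ where $\cong$ is homeomorphism and $\simeq$ is homotopy equivalence.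
   Context: A polytope of dimension $n$ is simple if exactly $n$ facets meet at each vertex. $K_P$ is the simplicial complex dual to the boundary of $P^n$: its vertices $1,\dots,m$ correspond to the facets $F_1,\dots,F_m$, and a set of vertices is a simplex iff the corresponding facets have non-empty intersection. A characteristic function is a map $\lambda:\{F_1,\dots,F_m\}\to\mathbb{Z}^n$ such that whenever $F_{i_1}\cap\cdots\cap F_{i_l}$ is a codimension-$l$ face, $\lambda(F_{i_1}),\dots,\lambda(F_{i_l})$ span a rank-$l$ direct summand of $\mathbb{Z}^n$. It is regarded as an $n\times m$ integer matrix, hence a homomorphism $T^m\to T^n$, with kernel $\ker\lambda\cong T^{m-n}$ in $T^m$. Polyhedral products: for a simplicial complex $K$ on $r$ vertices and pairs $(A_i,B_i)$, $i=1,\dots,r$, $Z(K;(\underline{A_i},\underline{B_i}))=\bigcup_{\sigma\in K}\prod_{i=1}^rC_i(\sigma)\subseteq\prod_iA_i$, with $C_i(\sigma)=A_i$ if $i\in\sigma$ and $C_i(\sigma)=B_i$ if $i\notin\sigma$. If all pairs equal $(D^2,S^1)$ this is the moment-angle complex $Z(K;(D^2,S^1))\subseteq(D^2)^r$, with coordinatewise action of $T^r$. $CX$ denotes the cone on $X$, with $X\subset CX$ as its base; a group action on $X$ extends to $CX$ preserving the cone parameter. $Z(K_i)\subseteq(D^2)^{j_i}$. Composed complex: $K_P(K_1,\dots,K_m)=\bigcup_{\sigma\in K_P}B_1(\sigma)*\cdots*B_m(\sigma)\subset\Delta^{j_1-1}*\cdots*\Delta^{j_m-1}$, where $B_i(\sigma)=\Delta^{j_i-1}$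 (the full simplex on the vertex set of $K_i$) if $i\in\sigma$, and $B_i(\sigma)=K_i$ if $i\notin\sigma$. It has $d(J)=j_1+\cdots+j_m$ vertices. Actions: $T^{d(J)}=T^{j_1}\times\cdots\times T^{j_m}$ acts coordinatewise on all the polyhedral products above. $\ker\lambda\subset T^m$ acts through the inclusion $T^m\hookrightarrow T^{d(J)}$ sending the $i$-th circle diagonally into $T^{j_i}=(S^1)^{j_i}$. The relation $\sim_2$: $T^m$ acts on $X_1\times\cdots\times X_m$ coordinatewise, and $\ker\lambda$ acts by restriction; for distinct indices $i_1,\dots,i_{m-k}$ it acts on $X_{i_1}\times\cdots\times X_{i_{m-k}}$ via the coordinate projection $T^m\to T^{m-k}$, and $\pi_{i_1,\dots,i_{m-k}}:(X_1\times\cdots\times X_m)/\ker\lambda\to(X_{i_1}\times\cdots\times X_{i_{m-k}})/\ker\lambda$ is the induced projection. On $\big((X_1\times\cdots\times X_m)/\ker\lambda\big)\times P^n$ set $(a,p)\sim_2(b,q)$ iff $p=q$ and $\pi_{i_1,\dots,i_{m-k}}(a)=\pi_{i_1,\dots,i_{m-k}}(b)$, where $F_{i_1},\dots,F_{i_{m-k}}$ are the facets of $P^n$ not containing $p$. *)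

(* Defs.v *)
From HB Require Import structures.
From Stdlib Require Import Relation_Operators.
From mathcomp Require Import all_boot all_order all_algebra.
From mathcomp Require Import generic_quotient complex.
From mathcomp Require Import all_classical all_reals all_analysis.

Set Implicit Arguments.
Unset Strict Implicit.
Unset Printing Implicit Defensive.

Import Order.TTheory GRing.Theory Num.Theory.
Import numFieldTopology.Exports numFieldNormedType.Exports.

Local Open Scope classical_set_scope.
Local Open Scope ring_scope.
Local Open Scope quotient_scope.

(** The quotient of [T] by the equivalence relation generated by [r]. All the
    relations [r] used below are equivalence relations already, except the one
    that collapses the top of a cylinder, which only lacks reflexivity. *)
Section TopQuotient.
Context {T : topologicalType} (r : T -> T -> Prop).

Definition gen_rel : rel T := fun x y => `[< clos_refl_sym_trans T r x y >].

Lemma gen_rel_refl : reflexive gen_rel.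
Proof. by move=> x; apply/asboolP; exact: rst_refl. Qed.

Lemma gen_rel_sym : symmetric gen_rel.
Proof. by move=> x y; apply/asboolP/asboolP; exact: rst_sym. Qed.

Lemma gen_rel_trans : transitive gen_rel.
Proof. by move=> y x z /asboolP xy /asboolP yz; apply/asboolP; exact: rst_trans yz. Qed.

Definition gen_equiv := EquivRel gen_rel gen_rel_refl gen_rel_sym gen_rel_trans.

Definition tquot : Type := quotient_topology {eq_quot gen_equiv}.

Lemma tquot_eqP (x y : T) :
  \pi_tquot x = \pi_tquot y <-> clos_refl_sym_trans T r x y.
Proof.
by split=> [/eqmodP/asboolP //|xy]; apply/eqmodP; apply/asboolP.
Qed.

End TopQuotient.

(** The map between quotients induced by [f], meaningful when [f] sends
    related points to related points, see [tquot_mapE]. *)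
Definition tquot_map {T U : topologicalType} (r : T -> T -> Prop)
    (r' : U -> U -> Prop) (f : T -> U) (c : tquot r) : tquot r' :=
  \pi_(tquot r') (f (repr c)).

Lemma tquot_mapE {T U : topologicalType} (r : T -> T -> Prop)
    (r' : U -> U -> Prop) (f : T -> U) :
  (forall x y, r x y -> r' (f x) (f y)) ->
  forall x, tquot_map r' f (\pi_(tquot r) x) = \pi_(tquot r') (f x).
Proof.
move=> rf x; apply/tquot_eqP.
have rstf a b : clos_refl_sym_trans T r a b -> clos_refl_sym_trans U r' (f a) (f b).
  elim=> {a b} [a b /rf|a|a b _|a b c _ ab _ bc].
  - exact: rst_step.
  - exact: rst_refl.
  - exact: rst_sym.
  - exact: rst_trans ab bc.
by apply/rstf/tquot_eqP; rewrite reprK.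
Qed.

Definition homeomorphic (X Y : topologicalType) : Prop :=
  exists (f : X -> Y) (g : Y -> X),
    [/\ continuous f, continuous g, cancel f g & cancel g f].

Definition unit_interval (R : realType) : set R := `[0, 1]%classic.
Arguments unit_interval : clear implicits.

Definition homotopic (R : realType) (X Y : topologicalType) (f g : X -> Y) :=
  exists h : X * unit_interval R -> Y,
    [/\ continuous h,
        forall x s, val s = 0 -> h (x, s) = f x &
        forall x s, val s = 1 -> h (x, s) = g x].

Definition homotopy_equivalent (R : realType) (X Y : topologicalType) : Prop :=
  exists (f : X -> Y) (g : Y -> X),
    [/\ continuous f, continuous g,
        homotopic R (g \o f) idfun & homotopic R (f \o g) idfun].

Definition cone_rel (R : realType) (X : topologicalType)
    (a b : X * unit_interval R) : Prop := val a.2 = 1 /\ val b.2 = 1.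

Definition cone (R : realType) (X : topologicalType) : topologicalType :=
  tquot (@cone_rel R X).

Definition cone_base (R : realType) (X : topologicalType) : set (cone R X) :=
  [set c | exists2 a : X * unit_interval R,
     val a.2 = 0 & c = \pi_(tquot (@cone_rel R X)) a].

Definition cone_map (R : realType) (X Y : topologicalType) (f : X -> Y)
    : cone R X -> cone R Y :=
  @tquot_map (X * unit_interval R)%type (Y * unit_interval R)%type
    (@cone_rel R X) (@cone_rel R Y) (fun a => (f a.1, a.2)).

Lemma cone_map_base (R : realType) (X Y : topologicalType) (f : X -> Y)
    (c : cone R X) : cone_base c -> cone_base (cone_map f c).
Proof.
by move=> [a a0 ->]; exists (f a.1, a.2) => //; rewrite /cone_map tquot_mapE.
Qed.

(** [G] is a subgroup, with neutral element [e], of a group with carrier [H]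
    that acts on [X] by [act]. *)
Definition acts_freely {H X : Type} (e : H) (G : set H) (act : H -> X -> X) :=
  forall t x, G t -> act t x = x -> t = e.

Definition orbit_space {H : Type} {X : topologicalType} (G : set H)
    (act : H -> X -> X) : topologicalType :=
  tquot (fun x y : X => exists2 t, G t & act t x = y).

(** Naming this structure gives [R[i]] the topology that the library puts on
    every [numClosedFieldType]. *)
Definition Cplx (R : realType) : numClosedFieldType := R[i].

Definition disc (R : realType) : set (Cplx R) := [set z | `|z| <= 1].
Definition circle (R : realType) : set (Cplx R) := [set z | `|z| = 1].
Arguments disc : clear implicits.
Arguments circle : clear implicits.

Lemma circle_unit (R : realType) : circle R 1.
Proof. exact: normr1. Qed.

Definition circle1 (R : realType) : circle R := exist _ 1 (mem_set (circle_unit R)).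

Definition circle_act (R : realType) (t : circle R) (z : Cplx R) : Cplx R :=
  val t * z.

Lemma circle_norm (R : realType) (t : circle R) : `|val t| = 1.
Proof. by case: t => z /= /set_mem. Qed.

Lemma circle_act_disc (R : realType) (t : circle R) (z : Cplx R) :
  disc R z -> disc R (circle_act t z).
Proof. by rewrite /disc /circle_act /= normrM circle_norm mul1r. Qed.

Lemma circle_act_circle (R : realType) (t : circle R) (z : Cplx R) :
  circle R z -> circle R (circle_act t z).
Proof. by rewrite /circle /circle_act /= normrM circle_norm mul1r. Qed.

Definition torus (R : realType) (m : nat) : Type := 'I_m -> circle R.

Definition torus1 (R : realType) (m : nat) : torus R m := fun=> circle1 R.

Arguments torus1 : clear implicits.

(** Column [i] of [L] is the weight of the [i]-th circle of [T^m]. *)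
Definition torus_ker (R : realType) (n m : nat) (L : 'M[int]_(n, m))
    : set (torus R m) :=
  [set t | forall k : 'I_n, \prod_(i < m) val (t i) ^ L k i = 1].

(** Vertices of the ambient set [V] need not belong to the complex. *)
Definition simplicial_complex (V : finType) (K : {set {set V}}) : Prop :=
  finset.set0 \in K /\ forall s t : {set V}, t \subset s -> s \in K -> t \in K.

Section Composition.
Context (m : nat) (j : 'I_m -> nat).

Definition joined_vertices : finType := {i : 'I_m & 'I_(j i)}.

Definition part (i : 'I_m) (t : {set joined_vertices}) : {set 'I_(j i)} :=
  [set v | Tagged (fun i => 'I_(j i)) v \in t]%SET.

Definition simplicial_join (B : forall i, {set {set 'I_(j i)}})
    : {set {set joined_vertices}} :=
  [set t | [forall i, part i t \in B i]]%SET.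

Definition composed_complex (KP : {set {set 'I_m}})
    (K : forall i, {set {set 'I_(j i)}}) : {set {set joined_vertices}} :=
  (\bigcup_(s in KP)
    simplicial_join (fun i => if i \in s then powerset [set: 'I_(j i)] else K i))%SET.

End Composition.

Section PolyhedralProduct.
Context (V : finType) (E : V -> topologicalType).

Definition polyhedral_product (K : {set {set V}}) (A B : forall i, set (E i))
    : set (prod_topology E) :=
  \bigcup_(s in [set` K])
    [set x | forall i, (if i \in s then A i else B i) (x i)].

Context (H : V -> Type) (act : forall i, H i -> E i -> E i).

Lemma polyhedral_product_act (K : {set {set V}}) (A B : forall i, set (E i)) :
  (forall i t x, A i x -> A i (act t x)) ->
  (forall i t x, B i x -> B i (act t x)) ->
  forall (t : forall i, H i) x, polyhedral_product K A B x ->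
  polyhedral_product K A B (fun i => act (t i) (x i)).
Proof.
move=> actA actB t x [s Ks sx]; exists s => // i.
by move: (sx i); case: ifP => _; [exact: actA|exact: actB].
Qed.

Definition pp_act (K : {set {set V}}) (A B : forall i, set (E i))
    (actA : forall i t x, A i x -> A i (act t x))
    (actB : forall i t x, B i x -> B i (act t x))
    (t : forall i, H i) (x : polyhedral_product K A B)
    : polyhedral_product K A B :=
  exist _ (fun i => act (t i) (val x i))
    (mem_set (polyhedral_product_act actA actB t (set_valP x))).

End PolyhedralProduct.

Definition polydisc (R : realType) (V : finType)
    : set (prod_topology (fun _ : V => Cplx R)) :=
  [set x | forall v, disc R (x v)].
Arguments polydisc : clear implicits.

Definition moment_angle (R : realType) (V : finType) (K : {set {set V}}) :=
  polyhedral_product (E := fun _ : V => Cplx R) K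
    (fun=> disc R) (fun=> circle R).
Arguments moment_angle R {V} K.

Definition moment_angle_act (R : realType) (V : finType) (K : {set {set V}})
    : (V -> circle R) -> moment_angle R K -> moment_angle R K :=
  @pp_act V (fun=> Cplx R) (fun=> circle R) (fun=> @circle_act R) K
    (fun=> disc R) (fun=> circle R)
    (fun=> @circle_act_disc R) (fun=> @circle_act_circle R).

Definition moment_angle_diag (R : realType) (V : finType) (K : {set {set V}})
    (t : circle R) : moment_angle R K -> moment_angle R K :=
  moment_angle_act (fun=> t).

Definition diag_act (R : realType) (V : finType) (t : circle R)
    (x : prod_topology (fun _ : V => Cplx R))
    : prod_topology (fun _ : V => Cplx R) :=
  fun v => circle_act t (x v).

Lemma diag_act_polydisc (R : realType) (V : finType) (t : circle R)
    (x : prod_topology (fun _ : V => Cplx R)) :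
  polydisc R V x -> polydisc R V (diag_act t x).
Proof. by move=> Dx v; exact: circle_act_disc. Qed.

Lemma diag_act_moment_angle (R : realType) (V : finType) (K : {set {set V}})
    (t : circle R) (x : prod_topology (fun _ : V => Cplx R)) :
  moment_angle R K x -> moment_angle R K (diag_act t x).
Proof.
move=> Kx; apply: (@polyhedral_product_act V (fun=> Cplx R) (fun=> circle R)
  (fun=> @circle_act R) K _ _ _ _ (fun=> t) x Kx) => _.
- exact: circle_act_disc.
- exact: circle_act_circle.
Qed.

Section Polytope.
Context (R : realType) (d : nat).
Implicit Types P S : set 'rV[R]_d.

(** [P] may be empty, and need not have full dimension in [R^d]. *)
Definition polytope P : Prop :=
  (exists (q : nat) (A : 'M[R]_(d, q)) (b : 'rV[R]_q),
     P = [set x | forall k, (x *m A) 0 k <= b 0 k]) /\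
  bounded_set P.

Definition face P S : Prop :=
  exists (c : 'cV[R]_d) (b : R),
    (forall x, P x -> (x *m c) 0 0 <= b) /\
    S = [set x | P x /\ (x *m c) 0 0 = b].

(** [S] contains [k + 1] affinely independent points, namely [x0] and the
    [x0 + row i A], and lies in their affine hull. In particular, [S] is not
    empty. *)
Definition affine_dim S (k : nat) : Prop :=
  exists (x0 : 'rV[R]_d) (A : 'M[R]_(k, d)),
    [/\ S x0, row_free A, forall i, S (x0 + row i A) &
        forall x, S x -> (x - x0 <= A)%MS].

Definition facet P S : Prop :=
  face P S /\ exists k, affine_dim P k.+1 /\ affine_dim S k.

Context (m : nat) (F : 'I_m -> set 'rV[R]_d).

Definition facet_enumeration P : Prop :=
  injective F /\ forall S, facet P S <-> exists i, F i = S.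

Definition facets_at (x : 'rV[R]_d) : {set 'I_m} := [set i | `[< F i x >]]%SET.

Definition simple_polytope P (n : nat) : Prop :=
  [/\ polytope P, affine_dim P n, facet_enumeration P &
      forall v, face P [set v] -> #|facets_at v| = n].

(** Intersecting with [P] only matters when [s] is empty. *)
Definition facets_inter P (s : {set 'I_m}) : set 'rV[R]_d :=
  [set x | P x /\ forall i, i \in s -> F i x].

Definition dual_complex P : {set {set 'I_m}} :=
  [set s | `[< (facets_inter P s !=set0)%classic >]]%SET.

End Polytope.

(** The columns of [A] span a direct summand of [Z^n] of rank [l]. *)
Definition spans_summand (n l : nat) (A : 'M[int]_(n, l)) : Prop :=
  \rank (map_mx (intr : int -> rat) A) = l /\
  exists N : set 'cV[int]_n,
    [/\ N 0, forall x y, N x -> N y -> N (x - y),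
        forall a : 'cV[int]_l, N (A *m a) -> A *m a = 0 &
        forall x, exists (a : 'cV[int]_l), exists2 y, N y & x = A *m a + y].

(** The value on the facet [F i] is column [i] of [L]. *)
Definition characteristic_function (R : realType) (d n m : nat)
    (P : set 'rV[R]_d) (F : 'I_m -> set 'rV[R]_d) (L : 'M[int]_(n, m)) : Prop :=
  forall (s : {set 'I_m}) (k : nat), (k + #|s|)%N = n ->
    affine_dim (facets_inter F P s) k ->
    spans_summand (colsub (fun l : 'I_#|s| => enum_val l) L).

Section Spaces.
Context (R : realType) (d n m : nat) (P : set 'rV[R]_d)
  (F : 'I_m -> set 'rV[R]_d) (L : 'M[int]_(n, m)).

Section TorusSpaces.
Context (X : 'I_m -> topologicalType) (act : forall i, circle R -> X i -> X i).

Definition sub_product (I : {set 'I_m}) : topologicalType :=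
  prod_topology (fun i : {i : 'I_m | i \in I} => X (val i)).

Definition sub_product_act (I : {set 'I_m}) (t : torus R m) (x : sub_product I)
    : sub_product I := fun i => act (t (val i)) (x i).

Definition full_product : topologicalType := prod_topology X.

Definition full_product_act (t : torus R m) (x : full_product)
    : full_product := fun i => act (t i) (x i).

Definition full_quotient := orbit_space (torus_ker L) full_product_act.

(** The projection [pi_{i_1, ..., i_{m-k}}], with [I = {i_1, ..., i_{m-k}}]. *)
Definition proj_quotient (I : {set 'I_m})
    : full_quotient -> orbit_space (torus_ker L) (@sub_product_act I) :=
  tquot_map _ (fun (x : full_product) => (fun i => x (val i)) : sub_product I).

Lemma proj_quotientE (I : {set 'I_m}) (x : full_product) :
  proj_quotient I (\pi_(tquot _) x) =
  \pi_(tquot _) ((fun i => x (val i)) : sub_product I).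
Proof. by apply: tquot_mapE => {}x y [t Lt <-]; exists t. Qed.

Definition sim2 (a b : full_quotient * P) : Prop :=
  a.2 = b.2 /\
  proj_quotient (~: facets_at F (val a.2)) a.1 =
  proj_quotient (~: facets_at F (val a.2)) b.1.

Definition sim2_space : topologicalType := tquot sim2.

Definition cone_product :=
  polyhedral_product (E := fun i => cone R (X i)) (dual_complex F P)
    (fun=> setT) (fun i => cone_base (X := X i)).

Definition cone_product_act : torus R m -> cone_product -> cone_product :=
  @pp_act 'I_m (fun i => cone R (X i)) (fun=> circle R)
    (fun i t => cone_map (act t)) (dual_complex F P) _ _
    (fun _ _ _ _ => I) (fun i t => @cone_map_base R _ _ (act t)).

Definition cone_product_quotient : topologicalType :=
  orbit_space (torus_ker L) cone_product_act.

End TorusSpaces.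

Context (j : 'I_m -> nat) (K : forall i, {set {set 'I_(j i)}}).

Definition disc_product :=
  polyhedral_product (E := fun i => prod_topology (fun _ : 'I_(j i) => Cplx R))
    (dual_complex F P)
    (fun i => polydisc R 'I_(j i))
    (fun i => moment_angle R (K i)).

Definition disc_product_act : torus R m -> disc_product -> disc_product :=
  @pp_act 'I_m (fun i => prod_topology (fun _ : 'I_(j i) => Cplx R))
    (fun=> circle R) (fun i => @diag_act R 'I_(j i)) (dual_complex F P) _ _
    (fun i => @diag_act_polydisc R 'I_(j i))
    (fun i => @diag_act_moment_angle R _ (K i)).

Definition disc_product_quotient : topologicalType :=
  orbit_space (torus_ker L) disc_product_act.

Definition composed_moment_angle :=
  moment_angle R (composed_complex (dual_complex F P) K).

(** [T^m] is included in [T^{d(J)}] by sending the [i]-th circle diagonally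
    to the circles indexed by the vertices of [K i]. *)
Definition composed_moment_angle_act (t : torus R m)
    : composed_moment_angle -> composed_moment_angle :=
  moment_angle_act (fun v => t (tag v)).

Definition composed_moment_angle_quotient : topologicalType :=
  orbit_space (torus_ker L) composed_moment_angle_act.

End Spaces.

(* Main.v *)
(** The polytope [P] is cut out of its affine hull by its facet inequalities
    (an irredundant system is one facet per inequality), so that every nonempty
    intersection of facets contains a vertex, where [n] facets meet in a single
    point, and moving away from that point gives a point lying on prescribed
    facets only. Choosing such a point [beta s] for each simplex [s] of [K_P], the
    map [u |-> \sum_s min_(i in s) u_i *: gamma s], where [gamma] is the Moebius
    inverse of [beta], is the piecewise linear homeomorphism from the cubical
    complex [{u in [0,1]^m | supp u in K_P}] onto [P] that sends [u_i = 1] to the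
    facet [F i]. Hence both sides of the first homeomorphism are quotients of
    [Z(K_P; (X_i x I, X_i x 0))] with the same fibres, and maps from a compact
    space to a Hausdorff one, as well as orbit maps, are quotient maps.

    For the homotopy equivalence, let [depth z] be the minimum over the nonfaces
    [t] of [K_i] of [max_(v in t) |z_v|]. It is [1] exactly on [Z(K_i)], and
    [z |-> [z_v / max (depth z) |z_v|, 1 - depth z]] is an equivariant map from
    the polydisc to the cone which is a left inverse of [[x, s] |-> (1 - s) x]
    and, up to a linear homotopy preserving [Z(K_i)], a right inverse. *)

Require Import Defs.
From Stdlib Require Import Relation_Operators.
From mathcomp Require Import all_boot all_order all_algebra.
From mathcomp Require Import generic_quotient complex.
From mathcomp Require Import all_classical all_reals all_analysis.
From mathcomp Require Import lra.

Set Implicit Arguments.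
Unset Strict Implicit.
Unset Printing Implicit Defensive.

Import Order.TTheory GRing.Theory Num.Theory.
Import numFieldTopology.Exports numFieldNormedType.Exports.

Local Open Scope classical_set_scope.
Local Open Scope ring_scope.
Local Open Scope complex_scope.
Local Open Scope quotient_scope.

(** * Polytopes and their facet inequalities *)

(** With [e = 1 / (1 + \sum_i |c i| / g i)] each [e * |c i| / g i] is below 1. This lets a point
    move a little without breaking strict inequalities whose gaps are [g]. *)
Lemma small_scale (R : realFieldType) (I : finType) (c g : I -> R) :
  (forall i, 0 < g i) -> exists2 e, 0 < e & forall i, e * c i < g i.
Proof.
move=> g0; pose s := 1 + \sum_i `|c i| / g i.
have term0 i : 0 <= `|c i| / g i by rewrite divr_ge0// ltW.
have s0 : 0 < s by rewrite ltr_wpDr// sumr_ge0.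
exists s^-1 => [|i]; first by rewrite invr_gt0.
rewrite mulrC ltr_pdivrMr// mulrC -ltr_pdivrMr//.
apply: (@le_lt_trans _ _ (`|c i| / g i)).
  by rewrite ler_wpM2r ?invr_ge0 ?ler_norm// ltW.
rewrite /s (bigD1 i)//= addrA [1 + _]addrC -addrA ltrDl.
by rewrite ltr_wpDr// sumr_ge0.
Qed.

(** A point with gaps [g] to finitely many constraints moves with slopes [c]; it first meets one of
    them at the least ratio [g i / c i] over the positive slopes. *)
Lemma first_hit (R : realFieldType) (I : finType) (c g : I -> R) :
  (forall i, 0 <= g i) -> (exists i, 0 < c i) ->
  exists2 t, 0 <= t & (forall i, t * c i <= g i) /\
    exists2 i, 0 < c i & t * c i = g i.
Proof.
move=> g0 [i0 ci0].
case: (@arg_minP _ _ _ i0 (fun i => 0 < c i) (fun i => g i / c i) ci0) => i ci imin.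
exists (g i / c i); first by rewrite divr_ge0// ltW.
split=> [k|]; last by exists i => //; rewrite divfK// gt_eqF.
have [ck|ck] := ltP 0 (c k); first by rewrite -ler_pdivlMr// imin.
by rewrite (le_trans _ (g0 k))// mulr_ge0_le0// divr_ge0// ltW.
Qed.

Lemma bounded_ray (R : realType) (d : nat) (P : set 'rV[R]_d) (p y : 'rV[R]_d) :
  bounded_set P -> (forall t, 0 <= t -> P (p + t *: y)) -> y = 0.
Proof.
move=> [M [_ /(_ (M + 1))]]; rewrite ltrDl ltr01 => /(_ isT) PM Pt.
apply/eqP; apply: contraT => y0; have ny : 0 < `|y| by rewrite normr_gt0.
(* The bound holds at every number above [M], hence at [M + 1]; this [t] gives [t *: y] the norm
   [|M + 1| + |p| + 1], which is too long. *)
have := PM _ (Pt ((`|M + 1| + `|p| + 1) / `|y|) _); rewrite divr_ge0//= => /(_ isT).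
set t := _ / _ => le1; have : `|t *: y| <= `|p + t *: y| + `|p|.
  by rewrite -{1}[t *: y](addrK p) [t *: y + p]addrC (le_trans (ler_normB _ _)).
have t0 : 0 <= t by rewrite divr_ge0.
rewrite normrZ ger0_norm// divfK ?gt_eqF// => le2.
by have := ler_norm (M + 1); lra.
Qed.

Lemma lt_segment (R : realFieldType) (q y b t : R) :
  q < b -> y <= b -> 0 < t -> t < 1 -> q + t * (y - q) < b.
Proof. by move=> qb yb t0 t1; nra. Qed.

Section Functional.
Context {R : realFieldType} {d : nat}.
Implicit Types (c : 'cV[R]_d) (x y : 'rV[R]_d).

Definition ev c x : R := (x *m c) 0 0.

Lemma evD c x y : ev c (x + y) = ev c x + ev c y.
Proof. by rewrite /ev mulmxDl mxE. Qed.

Lemma evZ c t x : ev c (t *: x) = t * ev c x.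
Proof. by rewrite /ev -scalemxAl mxE. Qed.

Lemma evB c x y : ev c (x - y) = ev c x - ev c y.
Proof. by rewrite /ev mulmxBl !mxE. Qed.

Lemma ev_sum c (I : finType) (x : I -> 'rV[R]_d) :
  ev c (\sum_i x i) = \sum_i ev c (x i).
Proof. by rewrite /ev mulmx_suml summxE. Qed.

Lemma ev_col q (A : 'M[R]_(d, q)) k x : ev (col k A) x = (x *m A) 0 k.
Proof. by rewrite /ev colE mulmxA -colE mxE. Qed.

Lemma ev_mul n (B : 'M[R]_(n, d)) c (u : 'rV[R]_n) :
  ev c (u *m B) = \sum_i u 0 i * ev c (row i B).
Proof.
rewrite /ev -mulmxA mxE; apply: eq_bigr => i _.
by rewrite -row_mul [in RHS]mxE.
Qed.

Lemma sub_line n (B : 'M[R]_(n, d)) x0 x y t :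
  (x - x0 <= B)%MS -> (y <= B)%MS -> (x + t *: y - x0 <= B)%MS.
Proof. by move=> xB yB; rewrite addrAC addmx_sub// scalemx_sub. Qed.

Lemma sub_diff n (B : 'M[R]_(n, d)) x0 x y :
  (x - x0 <= B)%MS -> (y - x0 <= B)%MS -> (x - y <= B)%MS.
Proof.
move=> xB yB; have -> : x - y = x - x0 - (y - x0) by rewrite opprB addrA subrK.
by rewrite addmx_sub// eqmx_opp.
Qed.

End Functional.

(** * Irredundant inequalities define facets *)

Section Description.
Context {R : realType} {d n : nat} (I : finType) (P : set 'rV[R]_d)
  (c : I -> 'cV[R]_d) (b : I -> R) (x0 : 'rV[R]_d) (B : 'M[R]_(n, d)).

(** Only points of the affine hull are tested, so that a minimal [T] contains no constraint that is
    tight on all of [P]; see [centre_strict]. *)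
Definition described (T : {set I}) :=
  forall x, (x - x0 <= B)%MS -> (forall k, k \in T -> ev (c k) x <= b k) -> P x.

Hypotheses (Pc : forall x, P x <-> forall k, ev (c k) x <= b k)
  (Px0 : P x0) (PB : forall i, P (x0 + row i B))
  (BP : forall x, P x -> (x - x0 <= B)%MS) (Bfree : row_free B).

Definition centre := x0 + (n.+1%:R)^-1 *: \sum_i row i B.

Lemma centre_sub : (centre - x0 <= B)%MS.
Proof.
by rewrite /centre addrC addKr scalemx_sub// summx_sub// => i _; exact: row_sub.
Qed.

(* [centre] is the barycentre of [n + 1] affinely independent points of [P], so a
   constraint that is tight there is tight at all of them. *)
Lemma centre_tight k : b k <= ev (c k) centre ->
  forall x, (x - x0 <= B)%MS -> ev (c k) x = b k.
Proof.
have g0 : ev (c k) x0 <= b k by apply: (iffLR (Pc _)).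
have gi i : ev (c k) (x0 + row i B) <= b k by apply: (iffLR (Pc _)).
rewrite /centre evD evZ ev_sum => le.
have n0 : 0 < n.+1%:R :> R by rewrite ltr0n.
have sum_le : \sum_i (b k - ev (c k) (x0 + row i B)) + (b k - ev (c k) x0) <= 0.
  under eq_bigr do rewrite evD opprD addrA.
  rewrite sumrB sumr_const card_ord -[X in _ + X]mulr1n -addrA [- _ + _]addrC addrA.
  rewrite -mulrnDr addn1 subr_le0 -mulr_natl -ler_pdivlMl//.
  by rewrite lerBlDl.
have sum0 : 0 <= \sum_i (b k - ev (c k) (x0 + row i B)).
  by apply: sumr_ge0 => i _; rewrite subr_ge0.
have x0k : ev (c k) x0 = b k by apply/le_anti; rewrite g0/=; lra.
have rk i : ev (c k) (row i B) = 0.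
  have : b k - ev (c k) (x0 + row i B) <= 0.
    have : \sum_(j | j != i) (b k - ev (c k) (x0 + row j B)) >= 0.
      by apply: sumr_ge0 => j _; rewrite subr_ge0.
    move: sum_le; rewrite (bigD1 i)//=; lra.
  by move: (gi i); rewrite evD; lra.
move=> x /submxP[u xu]; rewrite -[x](subrK x0) evD x0k xu ev_mul.
by rewrite big1 ?add0r// => i _; rewrite rk mulr0.
Qed.

Lemma centre_in : P centre.
Proof.
apply/Pc => k; rewrite leNgt; apply/negP => lt.
by have := centre_tight (ltW lt) centre_sub; move: lt => /[swap] ->; rewrite ltxx.
Qed.

Variable T : {set I}.
Hypotheses (TP : described T) (Tmin : forall k, k \in T -> ~ described (T :\ k)%SET).

(** A constraint tight at the centre holds with equality on the whole hull, so it could be deleted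
    from [T], against minimality. *)
Lemma centre_strict k : k \in T -> ev (c k) centre < b k.
Proof.
move=> kT; rewrite ltNge; apply/negP => /centre_tight bk.
apply: (Tmin kT) => x xB xT; apply: TP => // l lT.
by have [->|lk] := eqVneq l k; [rewrite bk|apply: xT; rewrite in_setD1 lk].
Qed.

Lemma irredundant_facet k : k \in T -> facet P [set x | P x /\ ev (c k) x = b k].
Proof.
move=> kT; split.
  by exists (c k), (b k); split => // x /Pc/(_ k).
(* [y] violates the constraint [k] only, so the segment from the centre to [y]
   leaves [P] through the relative interior of the face where [k] is tight. *)
have /existsNP[y /not_implyP[yB /not_implyP[yT nPy]]] := Tmin kT.
have yk : b k < ev (c k) y.
  rewrite ltNge; apply/negP => le; apply/nPy/TP => // l lT.
  by have [->//|lk] := eqVneq l k; apply: yT; rewrite in_setD1 lk.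
have qk := centre_strict kT.
pose t := (b k - ev (c k) centre) / (ev (c k) y - ev (c k) centre).
have t0 : 0 < t by rewrite divr_gt0; lra.
have t1 : t < 1 by rewrite ltr_pdivrMr; lra.
pose z := centre + t *: (y - centre).
have zB : (z - x0 <= B)%MS.
  by apply: sub_line; [exact: centre_sub|exact: sub_diff yB centre_sub].
have zk : ev (c k) z = b k by rewrite evD evZ evB divfK ?subrKC//; lra.
have zl l : l \in T -> l != k -> ev (c l) z < b l.
  move=> lT lk; rewrite /z (evD _ centre) evZ evB lt_segment ?centre_strict//.
  by apply: yT; rewrite in_setD1 lk.
(* The rows of [N] are a basis of the hull directions killed by [c k], and [M] holds their
   coordinates with respect to [B]. *)
pose M := kermx (B *m c k).
pose N := row_base M *m B.
(* [c k] takes different values at [centre] and [y], so its kernel on the hull directions has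
   codimension one. *)
have rankM : \rank M = (n - 1)%N.
  rewrite mxrank_ker; congr (_ - _)%N; apply/eqP.
  rewrite eqn_leq rank_leq_col lt0n mxrank_eq0; apply/eqP => Bc0.
  have /submxP[u yu] := sub_diff yB centre_sub.
  have : ev (c k) (y - centre) = 0 by rewrite yu /ev -mulmxA Bc0 mulmx0 mxE.
  by rewrite evB; lra.
have n0 : (0 < n)%N.
  rewrite lt0n; apply/eqP => n0.
  have /submxP[u yu] := sub_diff yB centre_sub.
  have : ev (c k) (y - centre) = 0.
    by rewrite yu ev_mul big1 // => i; have := ltn_ord i; rewrite {2}n0.
  by rewrite evB; lra.
have Nk i : ev (c k) (row i N) = 0.
  have : (row i (row_base M) <= M)%MS.
    by rewrite (submx_trans (row_sub _ _))// eq_row_base.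
  by rewrite /ev /N row_mul -mulmxA => /sub_kermxP ->; rewrite mxE.
(* The constraints other than [k] are strict at [z], so short multiples of the rows of [N] stay in
   [P] and give the remaining affinely independent points of the facet. *)
have [e e0 Ne] : exists2 e, 0 < e & forall i l, l \in T -> l != k ->
    e * ev (c l) (row i N) < b l - ev (c l) z.
  pose g (il : 'I_(\rank M) * I) := if (il.2 \in T) && (il.2 != k)
    then b il.2 - ev (c il.2) z else 1.
  have g0 il : 0 < g il.
    rewrite /g; case: ifP => // /andP[lT lk]; rewrite subr_gt0; exact: zl.
  have [e e0 He] := small_scale (fun il => ev (c il.2) (row il.1 N)) g0.
  exists e => // i l lT lk; have := He (i, l).
  by rewrite /g /= lT lk.
exists (\rank M); split.
  by rewrite rankM subn1 prednK//; exists x0, B.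
exists z, (e *: N); split.
- split => //; apply: TP => // l lT.
  by have [->|lk] := eqVneq l k; [rewrite zk|rewrite ltW// zl].
- rewrite /row_free; have -> : \rank (e *: N) = \rank N.
    by apply/eqmx_rank/eqmxP/eqmx_scale; rewrite gt_eqF.
  by rewrite mxrankMfree// eq_row_base.
- move=> i; rewrite linearZ /=; have zNB : (z + e *: row i N - x0 <= B)%MS.
    by apply: sub_line => //; rewrite row_mul submxMl.
  have zNk : ev (c k) (z + e *: row i N) = b k by rewrite evD evZ Nk mulr0 addr0.
  split => //; apply: TP => // l lT; have [->|lk] := eqVneq l k.
    by rewrite zNk.
  by rewrite evD evZ -lerBrDl ltW// Ne.
- move=> x [Px xk]; rewrite (eqmx_scale _ (lt0r_neq0 e0)).
  have /submxP[u xu] := sub_diff (BP Px) zB.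
  rewrite xu submxMr// eq_row_base; apply/sub_kermxP/rowP => i.
  by rewrite mulmxA -xu (ord1 i) -/(ev _ _) evB xk zk subrr mxE.
Qed.

End Description.

(** The inequalities of the [F i] come from the definition of a face and may differ from those of
    [A]. They are compared through a minimal subsystem of [A]: each of its constraints cuts out a
    facet, which is some [F i]. *)
Lemma polytope_facets (R : realType) (d n m : nat) (P : set 'rV[R]_d)
    (F : 'I_m -> set 'rV[R]_d) :
  polytope P -> affine_dim P n -> facet_enumeration F P ->
  exists (x0 : 'rV[R]_d) (B : 'M[R]_(n, d)) (c : 'I_m -> 'cV[R]_d) (b : 'I_m -> R),
  [/\ row_free B, P x0,
    forall x, P x <-> (x - x0 <= B)%MS /\ forall i, ev (c i) x <= b i &
    forall i, F i = [set x | P x /\ ev (c i) x = b i]].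
Proof.
move=> [[q [A [a PA]]] bP] [x0 [B [Px0 Bfree PB BP]]] [_ FP].
have Fface i : face P (F i) by have [_ /(_ (ex_intro _ i erefl))[]] := FP (F i).
have [c Fc] : {c : 'I_m -> 'cV[R]_d & forall i, exists b,
    (forall x, P x -> ev (c i) x <= b) /\ F i = [set x | P x /\ ev (c i) x = b]}.
  by apply: (@choice _ _ (fun i c => exists b,
    (forall x, P x -> ev c x <= b) /\ F i = [set x | P x /\ ev c x = b])).
have [b Fb] := choice Fc.
pose cA k := col k A.
have Pc x : P x <-> forall k, ev (cA k) x <= a 0 k.
  by rewrite PA /=; split => H k; move: (H k); rewrite ev_col.
exists x0, B, c, b; split => // [x|i]; last by have [] := Fb i.
split=> [Px|[xB xb]]; first by split=> [|i]; [exact: BP|apply: (Fb i).1].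
pose D (T : {set 'I_q}) := `[< described P cA (fun k => a 0 k) x0 B T >].
have DT : D [set: 'I_q]%SET.
  by apply/asboolP => y _ yT; apply/Pc => k; apply: yT; rewrite inE.
have [T /minsetP[/asboolP TP Tmin]] := ex_minset (ex_intro (fun T => D T) _ DT).
have {}Tmin k : k \in T -> ~ described P cA (fun k => a 0 k) x0 B (T :\ k)%SET.
  move=> kT /asboolP/Tmin/(_ (subsetDl _ _))/setP/(_ k).
  by rewrite in_setD1 kT eqxx.
pose z := centre x0 B.
have Pz : P z by apply: (centre_in Pc).
have zT k : k \in T -> ev (cA k) z < a 0 k.
  by move=> kT; apply: (centre_strict Pc Px0 PB TP Tmin).
(* If [x] is not in [P], the segment from [z] to [x] leaves [P] through a facet,
   and beyond that point it violates the inequality of this facet. *)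
apply: contrapT => nPx.
have /existsNP[k0 /not_implyP[k0T k0x]] :
    ~ forall k, k \in T -> ev (cA k) x <= a 0 k by move=> /(TP _ xB).
(* Outside [T] the slope 0 keeps a constraint from being the one that is hit. *)
pose slope k := if k \in T then ev (cA k) (x - z) else 0.
pose gap k := if k \in T then a 0 k - ev (cA k) z else 1.
have gap0 k : 0 < gap k by rewrite /gap; case: ifP => // kT; rewrite subr_gt0 zT.
have slope0 : exists k, 0 < slope k.
  exists k0; rewrite /slope k0T evB.
  by move/negP: k0x; rewrite -ltNge => k0x; have := zT _ k0T; lra.
have [t t0 [tle [k sk tk]]] := first_hit (fun k => ltW (gap0 k)) slope0.
have kT : k \in T by move: sk; rewrite /slope; case: ifP; rewrite ?ltxx.
have tpos : 0 < t.
  by rewrite lt_neqAle t0 andbT; apply/eqP => t00; move: tk (gap0 k);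
    rewrite -t00 mul0r => <-; rewrite ltxx.
pose w := z + t *: (x - z).
have Pw : P w.
  apply: TP => [|l lT].
    by apply: sub_line; [exact: centre_sub|exact: sub_diff xB (BP _ Pz)].
  by have := tle l; rewrite /slope /gap lT /w (evD _ z) evZ; lra.
have [i Fi] : exists i, F i = [set x | P x /\ ev (cA k) x = a 0 k].
  by apply/FP; exact: (irredundant_facet Pc Px0 PB BP Bfree TP Tmin).
have wk : ev (cA k) w = a 0 k.
  by move: tk; rewrite /slope /gap kT /w (evD _ z) evZ; lra.
have [cP Fic] := Fb i.
(* For [t >= 1] the point [x] would satisfy all constraints in [T]. *)
have t1 : t < 1.
  rewrite ltNge; apply/negP => t1; apply/nPx/TP => // l lT.
  have := tle l; rewrite /slope /gap lT evB; have := zT _ lT.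
  by move: t1; clear; nra.
have wi : ev (c i) w = b i.
  have : F i w by rewrite Fi.
  by rewrite Fic => -[].
(* [z] satisfies constraint [k] strictly, so it is not on [F i]. *)
have zi : ev (c i) z < b i.
  rewrite lt_neqAle cP// andbT; apply/eqP => zi.
  have : F i z by rewrite Fic.
  by rewrite Fi => -[_ zk]; have := zT _ kT; rewrite zk ltxx.
(* [c i] rises from below [b i] at [z] to [b i] at [w], strictly before [x], so it exceeds [b i] at
   [x]. *)
have := xb i; move: wi zi tpos t1; rewrite /w (evD _ z) evZ evB; clear; nra.
Qed.

(** * Parametrizing a simple polytope by a cubical complex *)

(** The relation at [t] determines [g t] from the values on proper subsets, so [g] is built by
    recursion on the cardinality. *)
Lemma moebius_inversion (I : finType) (V : zmodType) (f : {set I} -> V) :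
  exists g : {set I} -> V, forall t : {set I}, \sum_(s : {set I} | s \subset t) g s = f t.
Proof.
suff [g gf] : exists g : {set I} -> V, forall t : {set I}, (#|t| < #|I|.+1)%N ->
    \sum_(s : {set I} | s \subset t) g s = f t.
  by exists g => t; apply: gf; rewrite ltnS max_card.
elim: #|I|.+1 => [|N [g gf]]; first by exists (fun=> 0).
exists (fun t : {set I} => if (#|t| < N)%N then g t
  else f t - \sum_(s : {set I} | s \proper t) g s) => t tN.
rewrite (bigD1 t)//= [X in _ + X](_ : _ = \sum_(s : {set I} | s \proper t) g s).
  case: ifPn => [tN'|_]; last by rewrite subrK.
  rewrite -gf// [RHS](bigD1 t)//=; congr (_ + _).
  by apply: eq_bigl => s; rewrite finset.properEneq andbC.
apply: eq_big => [s|s /andP[st snt]]; first by rewrite finset.properEneq andbC.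
have : (#|s| < #|t|)%N by rewrite proper_card// finset.properEneq snt.
by move=> /leq_trans/(_ tN) ->.
Qed.

(** * Minima over sets of coordinates *)

Section MinOver.
Context {R : realFieldType} {I : finType}.
Implicit Types (u : I -> R) (s t : {set I}).

(* The minimum over the empty set is [1]. *)
Definition min_over u s : R := \big[Num.min/1]_(i in s) u i.

Lemma min_over_le u s i : i \in s -> min_over u s <= u i.
Proof. by move=> si; rewrite /min_over (bigD1 i)//= ge_min lexx. Qed.

Lemma min_over_le1 u s : min_over u s <= 1.
Proof. by rewrite /min_over; elim/big_rec: _ => // i x _ x1; rewrite ge_min x1 orbT. Qed.

Lemma min_over_attained u s :
  min_over u s = 1 \/ exists2 i, i \in s & min_over u s = u i.
Proof.
rewrite /min_over; elim/big_rec: _ => [|i x si IH]; first by left.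
by case: leP => _ //; right; exists i.
Qed.

Lemma min_over_eq u s x : x <= 1 -> (forall i, i \in s -> x <= u i) ->
  x = 1 \/ (exists2 i, i \in s & x = u i) -> min_over u s = x.
Proof.
move=> x1 xu xE; apply/le_anti/andP; split.
  by case: xE => [->|[i si ->]]; [exact: min_over_le1|exact: min_over_le].
by have [->|[i si ->]] := min_over_attained u s; [|exact: xu].
Qed.

(** The point at parameter [t] of the segment from the indicator of [s], a vertex of the cube, to
    [u]. *)
Definition mix (t : R) s u : I -> R := fun i => (1 - t) * (i \in s)%:R + t * u i.

Lemma min_over_indic s t : min_over (fun i => (i \in t)%:R) s = (s \subset t)%:R.
Proof.
have [st|/fintype.subsetPn[i si ti]] := boolP (s \subset t).
  by apply: min_over_eq; [|move=> i /(fintype.subsetP st) ->|left].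
apply: min_over_eq => [|k _|]; rewrite ?ler01 ?ler0n//.
by right; exists i; rewrite // (negPf ti).
Qed.

(** For [s] inside [s0] all coordinates involved are 1. Otherwise the minimum is reached outside
    [s0], where mixing multiplies by [t]. So [min_over] is affine along such segments, though not on
    the whole cube. *)
Lemma min_over_mix (t : R) s0 u s : 0 <= t <= 1 -> (forall i, 0 <= u i <= 1) ->
  (forall i, i \in s0 -> u i = 1) ->
  min_over (mix t s0 u) s = (1 - t) * (s \subset s0)%:R + t * min_over u s.
Proof.
move=> /andP[t0 t1] u01 us0.
have mix1 i : i \in s0 -> mix t s0 u i = 1.
  by move=> is0; rewrite /mix is0 us0// !mulr1 subrK.
have mix0 i : i \notin s0 -> mix t s0 u i = t * u i.
  by move=> is0; rewrite /mix (negPf is0) mulr0 add0r.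
have ule1 i : min_over u s <= 1 := min_over_le1 _ _.
have [ss0|/fintype.subsetPn[k ks ks0]] := boolP (s \subset s0).
  have -> : min_over u s = 1.
    by apply: min_over_eq; [|move=> i /(fintype.subsetP ss0)/us0 ->|left].
  rewrite !mulr1 subrK; apply: min_over_eq; [by []| |by left].
  by move=> i /(fintype.subsetP ss0)/mix1 ->.
rewrite mulr0 add0r; apply: min_over_eq.
- by have := min_over_le1 u s; nra.
- move=> i si; have := min_over_le u si; have [is0|is0] := boolP (i \in s0).
    by rewrite mix1//; have := min_over_le1 u s; nra.
  by rewrite mix0// => le; rewrite ler_wpM2l.
(* When the minimum of [u] is 1, by default or at an index of [s0], the index [k] outside [s0]
   attains it as well. *)
- have key : min_over u s = 1 -> exists2 i, i \in s & t * min_over u s = mix t s0 u i.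
    move=> min1; exists k => //; rewrite mix0//; congr (_ * _); apply/le_anti.
    by rewrite min_over_le//= min1; have /andP[] := u01 k.
  have [|[i si mini]] := min_over_attained u s; first by right; exact: key.
  have [is0|is0] := boolP (i \in s0); first by right; apply: key; rewrite mini us0.
  by right; exists i; rewrite // mix0// mini.
Qed.

End MinOver.

Lemma ev_suml (R : realFieldType) (d : nat) (I : finType) (s : {set I})
    (c : I -> 'cV[R]_d) (x : 'rV[R]_d) :
  ev (\sum_(i in s) c i) x = \sum_(i in s) ev (c i) x.
Proof. by rewrite /ev mulmx_sumr summxE. Qed.

(** * Vertices and faces of a simple polytope *)

Section SimplePolytope.
Context {R : realType} {d n m : nat} (P : set 'rV[R]_d) (F : 'I_m -> set 'rV[R]_d)
  (x0 : 'rV[R]_d) (B : 'M[R]_(n, d)) (c : 'I_m -> 'cV[R]_d) (b : 'I_m -> R).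
Hypotheses (Bfree : row_free B) (bP : bounded_set P)
  (PD : forall x, P x <-> (x - x0 <= B)%MS /\ forall i, ev (c i) x <= b i)
  (FD : forall i, F i = [set x | P x /\ ev (c i) x = b i])
  (simple : forall v, face P [set v] -> #|facets_at F v| = n).

Local Notation KP := (dual_complex F P).
Local Notation at_ := (facets_at F).

Lemma facets_atP x i : P x -> reflect (ev (c i) x = b i) (i \in at_ x).
Proof.
by move=> Px; rewrite inE; apply: (iffP (asboolP _)); rewrite FD => // -[].
Qed.

Lemma facet_le x i : P x -> ev (c i) x <= b i. Proof. by move=> /PD[_]. Qed.

Lemma facet_lt x i : P x -> i \notin at_ x -> ev (c i) x < b i.
Proof.
by move=> Px; rewrite lt_neqAle facet_le// andbT; apply: contra => /eqP/facets_atP-/(_ Px).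
Qed.

Lemma dual_complexP (s : {set 'I_m}) :
  reflect (exists2 x, P x & s \subset at_ x) (s \in KP).
Proof.
rewrite inE; apply: (iffP (asboolP _)) => -[x].
  move=> [Px sx]; exists x => //; apply/fintype.subsetP => i /sx Fx.
  by rewrite inE; apply/asboolP.
by move=> Px /fintype.subsetP sx; exists x; split=> // i /sx; rewrite inE => /asboolP.
Qed.

Lemma dual_complex_sub (s t : {set 'I_m}) : s \subset t -> t \in KP -> s \in KP.
Proof.
move=> st /dual_complexP[x Px tx]; apply/dual_complexP; exists x => //.
exact: fintype.subset_trans tx.
Qed.

(** The direction preserves the constraints tight at [x]. As [P] is bounded the ray must leave it,
    and the exit point lies on at least one more facet. *)
Lemma exit_point x y : P x -> (y <= B)%MS -> y != 0 ->
  (forall i, i \in at_ x -> ev (c i) y = 0) ->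
  exists2 t, 0 < t & P (x + t *: y) /\ at_ x \proper at_ (x + t *: y).
Proof.
move=> Px yB y0 yx.
have xB : (x - x0 <= B)%MS by have [] := (iffLR (PD _)) Px.
have slope : exists i, 0 < ev (c i) y.
  apply: contrapT => /forallNP H; move/eqP: y0; apply.
  apply: (@bounded_ray _ _ P x y bP) => t t0; apply/PD; split; first exact: sub_line.
  move=> i; rewrite evD evZ; have := facet_le i Px; have /negP := H i.
  by rewrite -leNgt; nra.
have gap i : 0 <= b i - ev (c i) x by rewrite subr_ge0 facet_le.
have [t t0 [tle [k sk tk]]] := first_hit gap slope.
have nk : k \notin at_ x by apply/negP => /yx k0; rewrite k0 ltxx in sk.
have tpos : 0 < t.
  by rewrite lt_neqAle t0 andbT; apply/eqP => t00; have := facet_lt Px nk;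
    rewrite -subr_gt0 -tk -t00 mul0r ltxx.
have Pt : P (x + t *: y).
  apply/PD; split; first exact: sub_line.
  by move=> i; rewrite evD evZ -lerBrDl.
exists t => //; split => //; apply/properP; split; last first.
  by exists k => //; apply/facets_atP; rewrite // evD evZ tk subrKC.
apply/fintype.subsetP => i ix; apply/facets_atP; rewrite // evD evZ yx// mulr0 addr0.
exact/facets_atP.
Qed.

(** The tight constraints leave no direction of the hull free. This form suits linear algebra; the
    proof of [vertex_card] links it to vertices as faces. *)
Definition vertex v := P v /\
  forall y, (y <= B)%MS -> (forall i, i \in at_ v -> ev (c i) y = 0) -> y = 0.

(* A point of the face lying on a maximal set of facets is a vertex. *)
Lemma exists_vertex s : s \in KP -> exists2 v, vertex v & s \subset at_ v.
Proof.
move=> /dual_complexP[x Px sx].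
pose H (t : {set 'I_m}) := `[< exists2 v, P v & s \subset at_ v /\ at_ v = t >].
have Hx : H (at_ x) by apply/asboolP; exists x.
have [t /maxsetP[/asboolP[v Pv [sv vt]] tmax]] :=
  ex_maxset (ex_intro (fun T => H T) _ Hx).
exists v => //; split => // y yB yv; apply: contrapT => /eqP y0.
have [e _ [Pe /[dup] ve /properP[vee _]]] := exit_point Pv yB y0 yv.
have E : at_ (v + e *: y) = at_ v.
  rewrite [RHS]vt; apply: tmax; last by rewrite -vt.
  apply/asboolP; exists (v + e *: y) => //; split => //.
  exact: fintype.subset_trans vee.
by move: ve; rewrite E fintype.properxx.
Qed.

Lemma vertex_unique v x : vertex v -> P x -> at_ v \subset at_ x -> x = v.
Proof.
move=> [Pv vker] Px /fintype.subsetP vx; apply/eqP; rewrite -subr_eq0; apply/eqP.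
apply: vker => [|i iv].
  by have [xB _] := (iffLR (PD _)) Px; have [vB _] := (iffLR (PD _)) Pv; exact: sub_diff xB vB.
have /(facets_atP _ Pv) iv' := iv; have /(facets_atP _ Px) ix := vx _ iv.
by rewrite evB iv' ix subrr.
Qed.

(** The sum of the inequalities tight at [v] is an inequality that is tight on [P] at [v] alone, so
    [v] is a face and simplicity counts its facets. *)
Lemma vertex_card v : vertex v -> #|at_ v| = n.
Proof.
move=> vv; have [Pv _] := vv; apply: simple.
exists (\sum_(i in at_ v) c i), (\sum_(i in at_ v) b i); split=> [x Px|].
  by rewrite -/(ev _ _) ev_suml ler_sum// => i _; exact: facet_le.
apply/seteqP; split=> [_ -> /=|x /= [Px]].
  split=> //; rewrite -/(ev _ _) ev_suml; apply: eq_bigr => i.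
  by move/facets_atP; apply.
rewrite -/(ev _ _) ev_suml => sumE; apply: vertex_unique => //.
apply/fintype.subsetP => i iv; apply/facets_atP => //; apply/eqP; apply: contraT => ix.
have : \sum_(k in at_ v) ev (c k) x < \sum_(k in at_ v) b k.
  rewrite (bigD1 i)//= [ltRHS](bigD1 i)//= ltr_leD// ?ler_sum// => [|k _].
    by rewrite lt_neqAle ix facet_le.
  exact: facet_le.
by rewrite sumE ltxx.
Qed.

Lemma vertex_inter v : vertex v -> facets_inter F P (at_ v) = [set v].
Proof.
move=> vv; apply/seteqP; split=> [x [Px vx]|_ ->] /=.
  apply: vertex_unique => //; apply/fintype.subsetP => i /vx Fx.
  by rewrite inE; apply/asboolP.
by have [Pv _] := vv; split => // i; rewrite inE => /asboolP.
Qed.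

(** At a vertex the [n] tight constraints form a basis of the functionals on the [n]-dimensional
    space of hull directions, so their slopes can be prescribed: 0 on [s], and -1 on the other
    facets there. *)
Lemma exists_relint s : s \in KP -> exists2 p, P p & at_ p = s.
Proof.
move=> /exists_vertex[v vv sv]; have [Pv vker] := vv.
pose S := at_ v.
pose M : 'M[R]_(n, #|S|) := \matrix_(k, l) ev (c (enum_val l)) (row k B).
have Mev (u : 'rV_n) (l : 'I_#|S|) : (u *m M) 0 l = ev (c (enum_val l)) (u *m B).
  by rewrite ev_mul mxE; apply: eq_bigr => k _; rewrite mxE.
have Mfree : row_free M.
  rewrite -kermx_eq0; apply/rowV0P => u /sub_kermxP uM.
  have : u *m B = 0.
    apply: vker => [|i iv]; first exact: submxMl.
    by have := Mev u (enum_rank_in iv i); rewrite uM mxE enum_rankK_in.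
  by move/eqP; rewrite mulmx_free_eq0// => /eqP.
(* [M] is square because exactly [n] facets meet at [v]. *)
have Mfull : row_full M.
  by rewrite /row_full (eqP Mfree) eq_sym; apply/eqP; exact: vertex_card.
(* Move away from the facets at [v] that are not in [s]. *)
pose w : 'rV[R]_#|S| := \row_l (if enum_val l \in s then 0 else - 1).
have /submxP[u uM] := submx_full w Mfull.
pose y := u *m B.
have ys i : i \in s -> ev (c i) y = 0.
  move=> si; have iv := fintype.subsetP sv i si.
  by have := Mev u (enum_rank_in iv i); rewrite -uM mxE enum_rankK_in// si.
have yS i : i \in S -> i \notin s -> ev (c i) y = - 1.
  move=> iv si; have := Mev u (enum_rank_in iv i).
  by rewrite -uM mxE enum_rankK_in// (negPf si).
(* The constraints tight at [v] have slope at most 0, so only the others restrict the step [e]. *)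
pose gap i := if i \in S then 1 else b i - ev (c i) v.
have gap0 i : 0 < gap i.
  by rewrite /gap; case: ifPn => // iS; rewrite subr_gt0 facet_lt.
have [e e0 He] := small_scale (fun i => ev (c i) y) gap0.
have ps i : i \in s -> ev (c i) (v + e *: y) = b i.
  move=> si; rewrite evD evZ ys// mulr0 addr0.
  by apply/facets_atP; rewrite // (fintype.subsetP sv).
have pns i : i \notin s -> ev (c i) (v + e *: y) < b i.
  move=> si; rewrite evD evZ; have [iS|iS] := boolP (i \in S).
    by rewrite yS//; have := facet_le i Pv; lra.
  by have := He i; rewrite /gap (negPf iS); lra.
have Pp : P (v + e *: y).
  apply/PD; split; first by apply: sub_line; [case: ((iffLR (PD _)) Pv)|exact: submxMl].
  by move=> i; have [/ps ->//|/pns/ltW] := boolP (i \in s).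
exists (v + e *: y) => //; apply/setP => i; apply/facets_atP/idP => //.
  by apply: contraPT => /pns + E; rewrite E ltxx.
exact: ps.
Qed.

Definition segment t (p q : 'rV[R]_d) := (1 - t) *: p + t *: q.

Lemma ev_segment i t p q : ev (c i) (segment t p q) = (1 - t) * ev (c i) p + t * ev (c i) q.
Proof. by rewrite /segment evD !evZ. Qed.

Lemma segmentE t p q : segment t p q = p + t *: (q - p).
Proof. by rewrite /segment scalerBl scale1r scalerBr addrAC addrA. Qed.

(** A combination, with positive weights of sum 1, of two numbers at most [b i] equals [b i] only if
    both do. *)
Lemma segment_in (t : R) p q : 0 < t -> t < 1 -> P p -> P q ->
  P (segment t p q) /\ at_ (segment t p q) = at_ p :&: at_ q.
Proof.
move=> t0 t1 Pp Pq; have Ps : P (segment t p q).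
  have [pB _] := (iffLR (PD _)) Pp; have [qB _] := (iffLR (PD _)) Pq.
  apply/PD; split; first by rewrite segmentE sub_line//; exact: sub_diff qB pB.
  by move=> i; rewrite ev_segment; have := facet_le i Pp; have := facet_le i Pq; nra.
split=> //; apply/setP => i; rewrite finset.in_setI.
apply/facets_atP/andP => //; rewrite ev_segment; last first.
  by move=> [/facets_atP-/(_ Pp) -> /facets_atP-/(_ Pq) ->]; rewrite -mulrDl subrK mul1r.
move=> E; have := facet_le i Pp; have := facet_le i Pq => pi qi.
by split; apply/facets_atP => //; nra.
Qed.

(** * The cubical complex and its map onto the polytope *)

Definition cube (u : 'I_m -> R) :=
  (forall i, 0 <= u i <= 1) /\ [set i | u i != 0]%SET \in KP.

(** These turn out to index the facets through [psi u], see [psi_in]. *)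
Definition tops (u : 'I_m -> R) := [set i | u i == 1]%SET.

Lemma tops_in u : cube u -> tops u \in KP.
Proof.
move=> [_]; apply: dual_complex_sub; apply/fintype.subsetP => i.
by rewrite !inE => /eqP ->; rewrite oner_eq0.
Qed.

Lemma cube_mix (t : R) (s : {set 'I_m}) u : 0 < t -> t <= 1 -> s \subset tops u ->
  cube u -> cube (mix t s u).
Proof.
move=> t0 t1 su [u01 uK].
have us i : i \in s -> u i = 1 by move=> /(fintype.subsetP su); rewrite inE => /eqP.
split=> [i|].
  have /andP[ui0 ui1] := u01 i; rewrite /mix; have [/us ->|_] := boolP (i \in s).
    by rewrite !mulr1 subrK ler01 lexx.
  by rewrite mulr0 add0r mulr_ge0 ?(ltW t0)//= mulr_ile1 ?(ltW t0).
apply: dual_complex_sub uK; apply/fintype.subsetP => i; rewrite !inE /mix.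
have [/us -> _|_] := boolP (i \in s); first by rewrite oner_eq0.
by rewrite mulr0 add0r mulf_eq0 negb_or => /andP[].
Qed.

Lemma tops_mix (t : R) (s : {set 'I_m}) u : 0 < t -> t < 1 -> s \subset tops u -> cube u ->
  tops (mix t s u) = s.
Proof.
move=> t0 t1 su [u01 uK]; apply/setP => i; rewrite !inE /mix.
have [/(fintype.subsetP su)|_] := boolP (i \in s).
  by rewrite inE => /eqP ->; rewrite !mulr1 subrK eqxx.
by rewrite mulr0 add0r lt_eqF//; have /andP[ui0 ui1] := u01 i; nra.
Qed.

(** Let [t] be the largest coordinate different from 1. Dividing the coordinates other than 1 by [t]
    gives [u'], which has more coordinates equal to 1, and [u] lies between the indicator of
    [tops u] and [u']. If [t = 0], then [u] is that indicator. *)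
Lemma cube_cases u : cube u -> u = (fun i => (i \in tops u)%:R) \/
  exists t u', [/\ 0 < t, t < 1, cube u', tops u \proper tops u' & u = mix t (tops u) u'].
Proof.
move=> cu; have [u01 uK] := cu.
have [u0|/existsNP[k /not_implyP[k1 k0]]] :=
    pselect (forall i, i \notin tops u -> u i = 0).
  left; apply/funext => i; have [|/u0//] := boolP (i \in tops u).
  by rewrite inE => /eqP.
right; case: (@arg_maxP _ _ _ k (fun i => i \notin tops u) u k1) => i it imax.
have t0 : 0 < u i.
  apply: (@lt_le_trans _ _ (u k)); last exact: imax.
  by rewrite lt_neqAle eq_sym; apply/andP; split; [exact/eqP|case/andP: (u01 k)].
have t1 : u i < 1.
  by move: it; rewrite inE lt_neqAle => ->; case/andP: (u01 i).
pose u' l := if l \in tops u then 1 else u l / u i.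
have u'1 l : l \in tops u -> u' l = 1 by rewrite /u' => ->.
exists (u i), u'; split=> //.
- split=> [l|].
    rewrite /u'; case: ifPn => [_|lt]; first by rewrite ler01 lexx.
    rewrite divr_ge0 ?(ltW t0)//=; last by case/andP: (u01 l).
    by rewrite ler_pdivrMr// mul1r; exact: imax.
  apply: dual_complex_sub uK; apply/fintype.subsetP => l; rewrite !inE /u'.
  case: ifPn; first by rewrite inE => /eqP -> _; rewrite oner_eq0.
  by move=> _; rewrite mulf_eq0 negb_or => /andP[].
- apply/properP; split; first by apply/fintype.subsetP => l /u'1; rewrite inE => ->.
  by exists i => //; rewrite inE /u' (negPf it) divff// gt_eqF.
- apply/funext => l; rewrite /mix /u'; case: ifPn => [|_].
    by rewrite inE => /eqP ->; rewrite !mulr1 subrK.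
  by rewrite mulr0 add0r mulrC divfK// gt_eqF.
Qed.

(** Induction on the number of coordinates different from 1, along the decomposition of
    [cube_cases]. *)
Lemma cube_ind (H : ('I_m -> R) -> Prop) :
  (forall s, s \in KP -> H (fun i => (i \in s)%:R)) ->
  (forall t s u, s \in KP -> 0 < t -> t < 1 -> cube u -> s \proper tops u -> H u ->
     H (mix t s u)) ->
  forall u, cube u -> H u.
Proof.
move=> H0 Hmix u; have [N] := ubnP (m - #|tops u|)%N; elim: N u => // N IH u uN cu.
have [->|[t [u' [t0 t1 cu' uu' ->]]]] := cube_cases cu; first exact/H0/tops_in.
apply: Hmix => //; first exact: tops_in.
apply: IH => //; rewrite -ltnS (leq_trans _ uN)// ltnS ltn_sub2l ?proper_card//.
by rewrite (leq_trans (proper_card uu'))// (leq_trans (max_card _))// card_ord.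
Qed.

Variables (beta gamma : {set 'I_m} -> 'rV[R]_d).
Hypotheses (Pbeta : forall s, s \in KP -> P (beta s))
  (at_beta : forall s, s \in KP -> at_ (beta s) = s)
  (gammaE : forall t : {set 'I_m}, \sum_(s : {set 'I_m} | s \subset t) gamma s = beta t).

(* By [gammaE] this is the Lovasz extension of [beta]: it is affine on the set of
   [u] whose coordinates have a given order. *)
Definition psi (u : 'I_m -> R) : 'rV[R]_d :=
  \sum_(s : {set 'I_m}) min_over u s *: gamma s.

Lemma psi_indic (s : {set 'I_m}) : psi (fun i => (i \in s)%:R) = beta s.
Proof.
rewrite -gammaE /psi [RHS]big_mkcond; apply: eq_bigr => t _.
by rewrite min_over_indic; case: ifP; rewrite ?scale1r ?scale0r.
Qed.

Lemma psi_mix (t : R) (s : {set 'I_m}) u : 0 < t -> t < 1 -> cube u -> s \subset tops u ->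
  psi (mix t s u) = segment t (beta s) (psi u).
Proof.
move=> t0 t1 [u01 _] su; rewrite /segment -psi_indic !scaler_sumr -big_split /=.
apply: eq_bigr => r _; rewrite min_over_mix ?(ltW t0) ?(ltW t1)//; last first.
  by move=> i /(fintype.subsetP su); rewrite inE => /eqP.
by rewrite min_over_indic !scalerA -scalerDl.
Qed.

(** [beta s] lies on the facets in [s] only and [psi u] on these and more, so a point strictly
    between them lies exactly on those in [s]. *)
Lemma psi_in u : cube u -> P (psi u) /\ at_ (psi u) = tops u.
Proof.
move: u; apply: (cube_ind (H := fun u => P (psi u) /\ at_ (psi u) = tops u))
  => [s sK|t s u sK t0 t1 cu su [Pu atu]].
  rewrite psi_indic at_beta//; split; first exact: Pbeta.
  by apply/setP => i; rewrite inE; case: (i \in s); rewrite ?eqxx// eq_sym oner_eq0.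
have su' := proper_sub su.
rewrite psi_mix// tops_mix//; have [? ->] := segment_in t0 t1 (Pbeta sK) Pu.
by split=> //; rewrite at_beta// atu; apply/finset.setIidPl.
Qed.

(** The facets at [psi u] recover [tops u]. So points with the same image lie on segments from one
    vertex; comparing where the ray from [beta s] meets a further facet gives equal parameters, and
    induction gives equal endpoints. *)
Lemma psi_inj u v : cube u -> cube v -> psi u = psi v -> u = v.
Proof.
move=> cu; move: u cu v.
have topsE u v : cube u -> cube v -> psi u = psi v -> tops u = tops v.
  by move=> cu cv E; have [_ <-] := psi_in cu; have [_ <-] := psi_in cv; rewrite E.
(* Equality would force [psi u = beta s], which lies on fewer facets. *)
have base s u t : s \in KP -> 0 < t -> t < 1 -> cube u -> s \proper tops u ->
    beta s <> segment t (beta s) (psi u).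
  move=> sK t0 t1 cu su; rewrite segmentE => /eqP; rewrite eq_sym -subr_eq0 addrC addKr.
  rewrite scaler_eq0 gt_eqF//= subr_eq0 => /eqP E; have [_] := psi_in cu.
  by rewrite E at_beta// => Es; move: su; rewrite -Es fintype.properxx.
apply: (cube_ind (H := fun u => forall v, cube v -> psi u = psi v -> u = v))
  => [s sK|t s u sK t0 t1 cu su IH] v cv.
  have [vE|[t [v' [t0 t1 cv' vv' vE]]]] := cube_cases cv.
    move=> E; rewrite vE; congr (fun s : {set 'I_m} => fun i => (i \in s)%:R).
    move: E; rewrite {1}vE !psi_indic => E; rewrite -(at_beta sK) E at_beta//.
    exact: tops_in.
  move=> E; have := topsE _ _ _ cv E.
  have cs : cube (fun i => (i \in s)%:R).
    split=> [i|]; first by rewrite ler0n lern1 leq_b1.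
    apply: dual_complex_sub sK; apply/fintype.subsetP => i; rewrite inE.
    by case: (i \in s); rewrite ?eqxx.
  move=> /(_ cs); have -> : tops (fun i => (i \in s)%:R) = s.
    by apply/setP => i; rewrite inE; case: (i \in s); rewrite ?eqxx// eq_sym oner_eq0.
  move=> sv; move: E; rewrite {1}vE psi_indic psi_mix ?proper_sub// -sv.
  by move=> /base[]; rewrite // sv.
have su' := proper_sub su.
have cm : cube (mix t s u) by apply: cube_mix => //; exact: ltW.
move=> E; have := topsE _ _ cm cv E; rewrite tops_mix// => sv.
move: E; rewrite psi_mix//.
have [->|[t' [v' [t'0 t'1 cv' vv' ->]]]] := cube_cases cv.
  by rewrite -sv psi_indic => /esym/base[].
rewrite -sv in vv' *; rewrite psi_mix ?proper_sub// => E.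
have [Pu atu] := psi_in cu; have [Pv' atv'] := psi_in cv'.
(* The ray from [beta s] leaves the face of [s] at a single point. *)
have trap t1' t2 p q : 0 < t1' -> t1' < t2 -> P p -> P q -> s \proper at_ q ->
    segment t1' (beta s) p = segment t2 (beta s) q -> False.
  move=> t10 t12 Pp Pq sq; rewrite !segmentE => /addrI Epq.
  have t20 : 0 < t2 := lt_trans t10 t12.
  (* [q] would lie strictly between [beta s] and [p], hence on no facet outside [s]. *)
  have qE : q = segment (t1' / t2) (beta s) p.
    rewrite segmentE mulrC -scalerA Epq scalerA mulVf ?gt_eqF// scale1r.
    by rewrite subrKC.
  have [| |_] := @segment_in (t1' / t2) (beta s) p _ _ (Pbeta sK) Pp.
  - by rewrite divr_gt0.
  - by rewrite ltr_pdivrMr// mul1r.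
  rewrite -qE at_beta// => Eq; move: sq; rewrite Eq => /properP[_ [l]].
  by rewrite finset.in_setI => /andP[->].
have [tt'|tt'|tt'] := ltgtP t t'.
- by case: (trap _ _ _ _ t0 tt' Pu Pv' _ E); rewrite atv'.
- by case: (trap _ _ _ _ t'0 tt' Pv' Pu _ (esym E)); rewrite atu.
rewrite -tt' in E *; congr mix; apply: IH => //; move: E; rewrite !segmentE => /addrI.
by move/(scalerI (lt0r_neq0 t0))/addIr.
Qed.

(** Push [p] away from [beta s] until it meets a further facet. The exit point is an image by
    induction, and [p] lies between it and [beta s]. *)
Lemma psi_surj p : P p -> exists2 u, cube u & psi u = p.
Proof.
have [N] := ubnP (m - #|at_ p|)%N; elim: N p => // N IH p pN Pp.
pose s := at_ p; have sK : s \in KP by apply/dual_complexP; exists p.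
have [pE|pE] := eqVneq p (beta s).
  exists (fun i => (i \in s)%:R); last by rewrite psi_indic -pE.
  split=> [i|]; first by rewrite ler0n lern1 leq_b1.
  apply: dual_complex_sub sK; apply/fintype.subsetP => i; rewrite inE.
  by case: (i \in s); rewrite ?eqxx.
have [pB _] := (iffLR (PD _)) Pp; have [bB _] := (iffLR (PD _)) (Pbeta sK).
have [||||t t0 [Pt st]] := @exit_point p (p - beta s) => //.
- exact: sub_diff pB bB.
- by rewrite subr_eq0.
- move=> i ip; rewrite evB; have : i \in at_ (beta s) by rewrite at_beta.
  by move: ip => /facets_atP-/(_ Pp) -> /facets_atP-/(_ (Pbeta sK)) ->; rewrite subrr.
have [] := IH _ _ Pt.
  rewrite -ltnS (leq_trans _ pN)// ltnS ltn_sub2l ?proper_card//.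
  by rewrite (leq_trans (proper_card st))// (leq_trans (max_card _))// card_ord.
move=> u cu uE; have [_ atu] := psi_in cu.
have su : s \subset tops u by rewrite -atu uE proper_sub.
have t10 : 0 < 1 + t by rewrite ltr_wpDr// ltW.
have i0 : 0 < (1 + t)^-1 by rewrite invr_gt0.
have i1 : (1 + t)^-1 < 1 by rewrite invf_lt1// ltrDl.
(* For [q = p + t *: (p - beta s)], the point [p] sits at parameter [1 / (1 + t)] of the segment
   from [beta s] to [q]. *)
exists (mix (1 + t)^-1 s u); first by apply: cube_mix => //; exact: ltW.
rewrite psi_mix// uE segmentE.
have -> : p + t *: (p - beta s) - beta s = (1 + t) *: (p - beta s).
  by rewrite scalerDl scale1r addrAC.
by rewrite scalerA mulVf ?gt_eqF// scale1r subrKC.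
Qed.

End SimplePolytope.

Lemma simple_polytope_cube (R : realType) (d n m : nat) (P : set 'rV[R]_d)
    (F : 'I_m -> set 'rV[R]_d) : simple_polytope F P n ->
  exists gamma : {set 'I_m} -> 'rV[R]_d,
  [/\ forall u, cube P F u -> P (psi gamma u) /\ facets_at F (psi gamma u) = tops u,
      forall u v, cube P F u -> cube P F v -> psi gamma u = psi gamma v -> u = v &
      forall p, P p -> exists2 u, cube P F u & psi gamma u = p].
Proof.
move=> [polyP dimP FP simple]; have [_ bP] := polyP.
have [x0 [B [c [b [Bfree _ PD FD]]]]] := polytope_facets polyP dimP FP.
have /choice[beta betaP] s : exists x, s \in dual_complex F P ->
    P x /\ facets_at F x = s.
  have [sK|] := boolP (s \in dual_complex F P); last by exists 0.
  by have [p Pp ps] := exists_relint Bfree bP PD FD simple sK; exists p.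
have [gamma gammaE] := moebius_inversion beta.
have Pbeta s : s \in dual_complex F P -> P (beta s) by move=> /betaP[].
have at_beta s : s \in dual_complex F P -> facets_at F (beta s) = s by move=> /betaP[].
exists gamma; split.
- exact: (psi_in PD FD Pbeta at_beta gammaE).
- exact: (psi_inj PD FD Pbeta at_beta gammaE).
- exact: (psi_surj bP PD FD Pbeta at_beta gammaE).
Qed.

Lemma simple_polytope_vertex (R : realType) (d n m : nat) (P : set 'rV[R]_d)
    (F : 'I_m -> set 'rV[R]_d) (s : {set 'I_m}) : simple_polytope F P n ->
  s \in dual_complex F P ->
  exists t : {set 'I_m}, [/\ s \subset t, #|t| = n & affine_dim (facets_inter F P t) 0].
Proof.
move=> [polyP dimP FP simple] sK; have [_ bP] := polyP.
have [x0 [B [c [b [Bfree _ PD FD]]]]] := polytope_facets polyP dimP FP.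
have [v vv sv] := exists_vertex bP PD FD sK.
exists (facets_at F v); split => //; first exact: (vertex_card PD FD simple vv).
rewrite (vertex_inter PD FD vv); exists v, 0; split => //.
- by rewrite /row_free mxrank0.
- by case.
- by move=> x /= ->; rewrite subrr sub0mx.
Qed.

(** * The free action and the composed complex *)

(** The complement [N] vanishes: for [y] in [N] the vector [\det A *: y = A *m (\adj A *m y)] is
    both in [N] and in the image of [A]. So [A] is onto, and a right inverse of a square matrix is
    also a left inverse. *)
Lemma spans_summand_unimodular (n : nat) (A : 'M[int]_n) :
  spans_summand A -> exists C : 'M[int]_n, C *m A = 1%:M.
Proof.
move=> [rkA [N [N0 NB NA AN]]].
have detA : \det A != 0.
  have : map_mx (intr : int -> rat) A \in unitmx.
    by rewrite -row_free_unit /row_free rkA.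
  by rewrite unitmxE unitfE det_map_mx intr_eq0.
have Nopp y : N y -> N (- y) by rewrite -sub0r; exact: NB.
have Nmuln y k : N y -> N (y *+ k).
  move=> Ny; elim: k => [|k IH]; first by rewrite mulr0n.
  by rewrite mulrSr -[X in _ + X]opprK; apply: NB => //; exact: Nopp.
have Nscale (z : int) y : N y -> N (z *: y).
  case: z => k Ny; first by rewrite -[Posz k]natz scaler_nat; exact: Nmuln.
  by rewrite NegzE scaleNr -natz scaler_nat; exact/Nopp/Nmuln.
have Ny0 y : N y -> y = 0.
  move=> /(Nscale (\det A)); rewrite -mul_scalar_mx -mul_mx_adj -mulmxA => /NA.
  rewrite mulmxA mul_mx_adj mul_scalar_mx => /matrixP y0.
  apply/matrixP => i k; have /eqP := y0 i k.
  by rewrite !mxE mulf_eq0 (negPf detA) => /eqP.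
have surj (x : 'cV[int]_n) : exists a, x = A *m a.
  by have [a [y /Ny0 -> ->]] := AN x; exists a; rewrite addr0.
have /choice[a aE] k := surj (delta_mx k 0).
pose C : 'M[int]_n := \matrix_(i, k) a k i 0.
exists C; apply: mulmx1C; apply/matrixP => i k; rewrite !mxE.
have := congr1 (fun M : 'cV_n => M i 0) (aE k); rewrite !mxE eqxx andbT => ->.
by apply: eq_bigr => l _; rewrite mxE.
Qed.

Lemma exprz_suml (F : fieldType) (I : finType) (x : F) (z : I -> int) :
  x != 0 -> x ^ (\sum_i z i) = \prod_i x ^ z i.
Proof.
by move=> x0; apply: (big_morph (fun z => x ^ z)) => // a b; exact: expfzDr.
Qed.

Lemma exprz_prodl (F : fieldType) (I : finType) (x : I -> F) (z : int) :
  (\prod_i x i) ^ z = \prod_i x i ^ z.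
Proof.
apply: (big_morph (fun x => x ^ z)) => [a b|]; [exact: expfzMl|exact: exp1rz].
Qed.

(** With [C] the integer inverse of [A], the product over [i] of the [i]-th relation to the power
    [C k i] isolates [t k]. *)
Lemma spans_summand_system (F : fieldType) (n l : nat) (A : 'M[int]_(n, l))
    (t : 'I_l -> F) : l = n -> spans_summand A -> (forall k, t k != 0) ->
  (forall i, \prod_k t k ^ A i k = 1) -> forall k, t k = 1.
Proof.
move=> ln; subst n => /spans_summand_unimodular[C CA] t0 tA k.
have -> : t k = \prod_i t i ^ (C *m A) k i.
  rewrite CA (bigD1 k)//= mxE eqxx big1 ?mulr1 ?expr1z// => i ik.
  by rewrite mxE eq_sym (negPf ik).
under eq_bigr do rewrite mxE exprz_suml//.
rewrite exchange_big big1//= => i _.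
under eq_bigr do rewrite mulrC -exprz_exp.
by rewrite -exprz_prodl tA exp1rz.
Qed.

(** The simplex [s] extends to the set [S] of facets at a vertex, whose columns of [L] form a
    unimodular matrix; a kernel element supported on [S] is then trivial. *)
Lemma torus_ker_trivial (R : realType) (d n m : nat) (P : set 'rV[R]_d)
    (F : 'I_m -> set 'rV[R]_d) (L : 'M[int]_(n, m)) (s : {set 'I_m}) (t : torus R m) :
  simple_polytope F P n -> characteristic_function P F L -> s \in dual_complex F P ->
  torus_ker L t -> (forall i, i \notin s -> t i = circle1 R) -> t = torus1 R m.
Proof.
move=> hP hL sK tL ts; have [S [sS cardS dimS]] := simple_polytope_vertex hP sK.
have t1 i : i \notin S -> val (t i) = 1.
  by move=> iS; rewrite ts//; apply: contra iS; exact: fintype.subsetP.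
have t0 i : val (t i) != 0 :> Cplx R by rewrite -normr_eq0 circle_norm oner_eq0.
have tS (l : 'I_#|S|) : val (t (enum_val l)) = 1.
  move: l; apply: (spans_summand_system cardS (hL S 0%N cardS dimS)) => [//|k].
  rewrite -[RHS](tL k) [RHS](bigID (mem S))/=.
  rewrite [X in _ * X]big1 ?mulr1 => [|i iS]; last by rewrite t1// exp1rz.
  by rewrite [RHS]big_enum_val /=; apply: eq_bigr => i _; rewrite mxE.
apply/funext => i; apply: val_inj => /=.
have [iS|/t1//] := boolP (i \in S).
by have := tS (enum_rank_in iS i); rewrite enum_rankK_in.
Qed.

Definition elt (T : Type) (A : set T) (x : T) (Ax : A x) : A := exist _ x (mem_set Ax).

(** * Continuity in products, subspaces and quotients *)

Section Continuity.

Lemma continuous_prod (X : topologicalType) (I : eqType) (E : I -> topologicalType)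
    (f : X -> prod_topology E) :
  (forall i, continuous (fun x => f x i)) -> continuous f.
Proof.
move=> cf x; apply/cvg_sup => i; move: x.
apply/(@continuousP _ (initial_topology (@^~ i))) => A [B oB <-].
by rewrite -comp_preimage; move/continuousP: (cf i); exact.
Qed.

Lemma continuous_proj (I : eqType) (E : I -> topologicalType) (i : I) :
  continuous (fun x : prod_topology E => x i).
Proof. exact: proj_continuous. Qed.

Lemma continuous_val (X : topologicalType) (A : set X) :
  continuous (val : A -> X).
Proof. exact: initial_continuous. Qed.

Lemma continuous_set_type (X Y : topologicalType) (A : set X) (f : Y -> A) :
  continuous (fun y => val (f y)) -> continuous f.
Proof. exact: (@continuous_comp_initial A Y X val f). Qed.

Lemma tquot_surj (X : topologicalType) (r : X -> X -> Prop) (a : tquot r) :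
  exists x, a = \pi_(tquot r) x.
Proof. by exists (repr a); rewrite reprK. Qed.

Lemma tquot_map_continuous (X Y : topologicalType) (r : X -> X -> Prop)
    (r' : Y -> Y -> Prop) (f : X -> Y) :
  continuous f -> (forall x y, r x y -> r' (f x) (f y)) ->
  continuous (@tquot_map X Y r r' f).
Proof.
move=> cf rf; apply/quotient_continuous.
have -> : @tquot_map X Y r r' f \o \pi_(tquot r) = \pi_(tquot r') \o f.
  by apply/funext => x; exact: tquot_mapE.
by move=> x; apply: continuous_comp; [exact: cf|exact: pi_continuous].
Qed.

Lemma orbit_space_homeomorphic (H : Type) (X Y : topologicalType) (G : set H)
    (actX : H -> X -> X) (actY : H -> Y -> Y) (f : X -> Y) (g : Y -> X) :
  continuous f -> continuous g -> cancel f g -> cancel g f ->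
  (forall t x, f (actX t x) = actY t (f x)) ->
  homeomorphic (orbit_space G actX) (orbit_space G actY).
Proof.
move=> cf cg fg gf fact.
have rf x y : (exists2 t, G t & actX t x = y) -> exists2 t, G t & actY t (f x) = f y.
  by move=> [t Gt <-]; exists t.
have rg x y : (exists2 t, G t & actY t x = y) -> exists2 t, G t & actX t (g x) = g y.
  by move=> [t Gt <-]; exists t => //; apply: (can_inj fg); rewrite fact !gf.
exists (tquot_map _ f), (tquot_map _ g); split.
- exact: tquot_map_continuous.
- exact: tquot_map_continuous.
- by move=> a; have [x ->] := tquot_surj a; rewrite !tquot_mapE// fg.
- by move=> a; have [x ->] := tquot_surj a; rewrite !tquot_mapE// gf.
Qed.

End Continuity.

(** * Polyhedral products over joined vertices *)

Section Currying.
Context {R : realType} {m : nat} (j : 'I_m -> nat) (KP : {set {set 'I_m}})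
  (K : forall i : 'I_m, {set {set 'I_(j i)}}).

Local Notation uncurried := (prod_topology (fun _ : joined_vertices j => Cplx R)).
Local Notation curried :=
  (prod_topology (fun i : 'I_m => prod_topology (fun _ : 'I_(j i) => Cplx R))).

Definition curry_vertices (x : uncurried) : curried :=
  fun i v => x (Tagged (fun i => 'I_(j i)) v).

Definition uncurry_vertices (x : curried) : uncurried := fun v => x (tag v) (tagged v).

Lemma continuous_uncurry_vertices : continuous uncurry_vertices.
Proof.
apply: continuous_prod => -[i v] x.
apply: (continuous_comp (f := fun x : curried => x i)
  (g := fun y : prod_topology (fun=> Cplx R) => y v)); exact: continuous_proj.
Qed.

Lemma continuous_curry_vertices : continuous curry_vertices.
Proof.
by apply: continuous_prod => i; apply: continuous_prod => v; exact: continuous_proj.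
Qed.

Lemma circle_disc (z : Cplx R) : circle R z -> disc R z.
Proof. by rewrite /circle /disc /= => ->. Qed.

(** A simplex of the composed complex is a choice, for each [i], of a simplex of [K i], or of any
    vertex set when [i] is in [s]; in that case the full simplex is the largest choice and gives the
    polydisc. *)
Lemma composed_moment_angleE (x : uncurried) :
  moment_angle R (composed_complex KP K) x <->
  polyhedral_product KP (fun i => polydisc R 'I_(j i)) (fun i => moment_angle R (K i))
    (curry_vertices x).
Proof.
split=> [[t /= /bigcupP[s sK]]|[s /= sK xs]].
  rewrite inE => /forallP st xt; exists s => // i; case: ifPn => si.
    move=> v; have := xt (Tagged (fun i => 'I_(j i)) v); case: ifP => // _; exact: circle_disc.
  exists (part i t); first by have := st i; rewrite (negPf si).
  by move=> v; have := xt (Tagged (fun i => 'I_(j i)) v); rewrite inE.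
have /(_ _)/cid T i : exists t,
    t \in (if i \in s then powerset [set: 'I_(j i)]%SET else K i) /\
    forall v, (if v \in t then disc R else circle R) (curry_vertices x v).
  have := xs i; case: ifPn => si; last by move=> [t Kt xt]; exists t.
  by move=> xi; exists [set: 'I_(j i)]%SET; split=> [|v]; rewrite ?powersetE ?inE.
exists [set v | tagged v \in sval (T (tag v))]%SET.
  apply/bigcupP; exists s => //; rewrite inE; apply/forallP => i.
  have -> : part i [set v | tagged v \in sval (T (tag v))]%SET = sval (T i).
    by apply/setP => v; rewrite !inE.
  by have [] := svalP (T i).
by move=> [i v]; rewrite inE; have [_] := svalP (T i); exact.
Qed.

End Currying.

Section ComposedComplex.
Context {R : realType} {d n m : nat} (P : set 'rV[R]_d) (F : 'I_m -> set 'rV[R]_d)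
  (L : 'M[int]_(n, m)) (j : 'I_m -> nat) (K : forall i : 'I_m, {set {set 'I_(j i)}}).

(** A point over the simplex [s] has its block [i] in the moment-angle complex of [K i] for [i]
    outside [s], where freeness forces [t i = 1]. *)
Lemma composed_action_free :
  simple_polytope F P n -> characteristic_function P F L ->
  (forall i, acts_freely (circle1 R) setT (moment_angle_diag (K := K i))) ->
  acts_freely (torus1 R m) (torus_ker L)
    (composed_moment_angle_act (P := P) (F := F) (K := K)).
Proof.
move=> hP hL hfree t x tL tx.
have /composed_moment_angleE[s sK xs] := set_valP x.
apply: (torus_ker_trivial hP hL sK tL) => i si.
have := xs i; rewrite (negPf si) => xi.
apply: (hfree i (t i) (elt xi) I); apply: val_inj.
apply/funext => v /=; have /(congr1 val)/= := tx.
by move=> /(congr1 (fun y => y (Tagged (fun i => 'I_(j i)) v))).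
Qed.

Lemma uncurry_verticesK : cancel (@uncurry_vertices R m j) (@curry_vertices R m j).
Proof. by []. Qed.

Lemma curry_verticesK : cancel (@curry_vertices R m j) (@uncurry_vertices R m j).
Proof. by move=> x; apply/funext => -[]. Qed.

Lemma composed_moment_angle_homeomorphic :
  homeomorphic (disc_product_quotient P F L K) (composed_moment_angle_quotient P F L K).
Proof.
have fP (x : disc_product P F K) :
    moment_angle R (composed_complex (dual_complex F P) K) (uncurry_vertices (val x)).
  by apply/composed_moment_angleE; exact: set_valP x.
have gP (x : composed_moment_angle P F K) :
    disc_product P F K (curry_vertices (val x)).
  by apply/composed_moment_angleE; exact: set_valP x.
apply: (@orbit_space_homeomorphic _ _ _ _ _ _
  (fun x => elt (fP x)) (fun x => elt (gP x))) => //.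
- apply: continuous_set_type => x; apply: continuous_comp.
    exact: continuous_val.
  exact: continuous_uncurry_vertices.
- apply: continuous_set_type => x; apply: continuous_comp.
    exact: continuous_val.
  exact: continuous_curry_vertices.
- by move=> x; apply: val_inj => /=; rewrite uncurry_verticesK.
- by move=> x; apply: val_inj => /=; rewrite curry_verticesK.
- by move=> t x; apply: val_inj.
Qed.

End ComposedComplex.

(** * Quotient maps and orbit spaces *)

Section QuotientMap.

Definition quotient_map (X Y : topologicalType) (f : X -> Y) :=
  (forall y, exists x, f x = y) /\ forall U : set Y, open (f @^-1` U) <-> open U.

Lemma quotient_map_continuous (X Y : topologicalType) (f : X -> Y) :
  quotient_map f -> continuous f.
Proof. by move=> [_ fo]; apply/continuousP => U /fo. Qed.

Lemma quotient_map_comp (X Y Z : topologicalType) (f : X -> Y) (g : Y -> Z) :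
  quotient_map f -> quotient_map g -> quotient_map (g \o f).
Proof.
move=> [fs fo] [gs go]; split=> [z|U].
  by have [y <-] := gs z; have [x <-] := fs y; exists x.
by rewrite comp_preimage; split=> [/fo/go|/go/fo].
Qed.

Lemma quotient_map_factor (X Y Z : topologicalType) (f : X -> Y) (g : X -> Z) (h : Y -> Z) :
  quotient_map f -> continuous g -> (forall x, h (f x) = g x) -> continuous h.
Proof.
move=> [_ fo] /continuousP gc hf; apply/continuousP => U /gc; rewrite -fo.
by congr open; apply/funext => x /=; rewrite hf.
Qed.

(** Both targets are the same quotient of [X]: sections of [f] and [g] give the two maps, which are
    continuous because they factor continuous maps through quotient maps. *)
Lemma quotient_map_homeomorphic (X Y Z : topologicalType) (f : X -> Y) (g : X -> Z) :
  quotient_map f -> quotient_map g -> (forall x x', f x = f x' <-> g x = g x') ->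
  homeomorphic Y Z.
Proof.
move=> qf qg fg; have [fs _] := qf; have [gs _] := qg.
have [sf sfK] := choice fs; have [sg sgK] := choice gs.
have hf x : g (sf (f x)) = g x by apply/fg; rewrite sfK.
have hg x : f (sg (g x)) = f x by apply/fg; rewrite sgK.
exists (g \o sf), (f \o sg); split.
- exact: quotient_map_factor qf (quotient_map_continuous qg) hf.
- exact: quotient_map_factor qg (quotient_map_continuous qf) hg.
- by move=> y /=; rewrite hg sfK.
- by move=> z /=; rewrite hf sgK.
Qed.

Lemma quotient_map_pi (X : topologicalType) (r : X -> X -> Prop) :
  quotient_map (\pi_(tquot r) : X -> tquot r).
Proof. by split=> [a|U //]; have [x ->] := tquot_surj a; exists x. Qed.

Lemma quotient_map_closed (X Y : topologicalType) (f : X -> Y) :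
  compact [set: X] -> hausdorff_space Y -> continuous f ->
  (forall y, exists x, f x = y) -> quotient_map f.
Proof.
move=> cX hY cf fs; split=> // U; split; last by move/continuousP: cf; exact.
move=> oU; rewrite -[U]setCK openC.
have -> : ~` U = f @` (~` (f @^-1` U)).
  apply/seteqP; split=> [y Uy|_ [x Ux <-]//].
  by have [x xy] := fs y; exists x => //=; rewrite xy.
apply: compact_closed => //; apply: continuous_compact.
  exact: continuous_subspaceT.
apply: (subclosed_compact _ cX) => //; exact: open_closedC.
Qed.

Definition open_map (X Y : topologicalType) (f : X -> Y) :=
  forall U : set X, open U -> open (f @` U).

Lemma quotient_map_open (X Y : topologicalType) (f : X -> Y) :
  open_map f -> continuous f -> (forall y, exists x, f x = y) -> quotient_map f.
Proof.
move=> of_ cf fs; split=> // U; split; last by move/continuousP: cf; exact.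
move=> /of_; congr open; apply/seteqP; split=> [_ [x Ux <-]//|y Uy].
by have [x xy] := fs y; exists x => //=; rewrite xy.
Qed.

Lemma open_map_prodl (X Y Z : topologicalType) (f : X -> Y) :
  open_map f -> open_map (fun a : X * Z => (f a.1, a.2)).
Proof.
move=> of_ U; rewrite !openE => oU _ [[x z] Uxz <-] /=.
have [[A B] /= [Ax Bz] ABU] := oU _ Uxz.
exists (f @` A^°, B) => /=.
  split=> //; apply: open_nbhs_nbhs; split; first by apply: of_; exact: open_interior.
  by exists x.
by move=> [y w] /= [[a /interior_subset Aa <-] Bw]; exists (a, w) => //; exact: ABU.
Qed.

Lemma continuous_pair (X Y Z : topologicalType) (f : X -> Y) (g : X -> Z) :
  continuous f -> continuous g -> continuous (fun x => (f x, g x)).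
Proof. by move=> cf cg x; apply: cvg_pair; [exact: cf|exact: cg]. Qed.

Lemma continuous_fst (X Y : topologicalType) : continuous (fst : X * Y -> X).
Proof. by move=> x; exact: cvg_fst. Qed.

Lemma continuous_snd (X Y : topologicalType) : continuous (snd : X * Y -> Y).
Proof. by move=> x; exact: cvg_snd. Qed.

Lemma continuous_o (X Y Z : topologicalType) (f : X -> Y) (g : Y -> Z) :
  continuous f -> continuous g -> continuous (fun x => g (f x)).
Proof. by move=> cf cg x; apply: continuous_comp; [exact: cf|exact: cg]. Qed.

(** Openness is asked for because the product of a quotient map with an identity need not be a
    quotient map, whereas open maps are stable under such products. *)
Lemma quotient_map_prodl (X Y Z : topologicalType) (f : X -> Y) :
  open_map f -> continuous f -> (forall y, exists x, f x = y) ->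
  quotient_map (fun a : X * Z => (f a.1, a.2)).
Proof.
move=> of_ cf fs; apply: quotient_map_open; first exact: open_map_prodl.
  apply: continuous_pair; last exact: continuous_snd.
  by apply: continuous_o cf; exact: continuous_fst.
by move=> [y z]; have [x <-] := fs y; exists (x, z).
Qed.

End QuotientMap.

(** * Compactness and separation *)

Section Compactness.

Lemma compact_set_type (X : topologicalType) (A : set X) :
  compact A -> compact [set: A].
Proof.
move=> cA G PG _.
have [|p [Ap clp]] := cA (val @ G) (fmap_proper_filter val PG).
  by apply: (@filterS _ G _ setT) (filterT) => a _; exact: set_valP.
exists (elt Ap); split=> // S U GS [_ [[V oV <-] Vp VU]].
have GvS : (val @ G) (val @` S).
  by apply: (@filterS _ G _ S) GS => a Sa; exists a.
have Vn : nbhs p V by apply: open_nbhs_nbhs.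
have [_ [[a Sa <-] Va]] := clp _ _ GvS Vn.
by exists a; split=> //; exact: VU.
Qed.

Lemma hausdorff_inj (X Y : topologicalType) (f : X -> Y) :
  continuous f -> injective f -> hausdorff_space Y -> hausdorff_space X.
Proof.
move=> cf finj hY x y clxy; apply/finj/hY => A B Ax By.
by have [z [Az Bz]] := clxy _ _ (cf _ _ Ax) (cf _ _ By); exists (f z).
Qed.

Lemma hausdorff_set_type (X : topologicalType) (A : set X) :
  hausdorff_space X -> hausdorff_space A.
Proof. by apply: hausdorff_inj; [exact: continuous_val|exact: val_inj]. Qed.

Lemma hausdorff_pair (X Y : topologicalType) :
  hausdorff_space X -> hausdorff_space Y -> hausdorff_space (X * Y)%type.
Proof.
move=> hX hY [x y] [x' y'] cl; congr (_, _).
  apply: hX => A B Ax Bx.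
  have [z [Az Bz]] := cl _ _ (@continuous_fst X Y (x, y) A Ax)
    (@continuous_fst X Y (x', y') B Bx).
  by exists z.1.
apply: hY => A B Ay By.
have [z [Az Bz]] := cl _ _ (@continuous_snd X Y (x, y) A Ay)
  (@continuous_snd X Y (x', y') B By).
by exists z.2.
Qed.

Lemma hausdorff_prod (I : eqType) (E : I -> topologicalType) :
  (forall i, hausdorff_space (E i)) -> hausdorff_space (prod_topology E).
Proof. exact: hausdorff_product. Qed.

Lemma compact_polyhedral_product (V : finType) (E : V -> topologicalType)
    (K : {set {set V}}) (A B : forall i, set (E i)) :
  (forall i, compact (A i)) -> (forall i, compact (B i)) ->
  compact (polyhedral_product K A B).
Proof.
move=> cA cB; rewrite /polyhedral_product.
have -> : [set` K] = [set` enum K] by apply/funext => s /=; rewrite mem_enum.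
rewrite bigcup_seq; apply: bigsetU_compact => s _.
apply: (@tychonoff V E (fun i => if i \in s then A i else B i)) => i.
by case: ifP.
Qed.

End Compactness.

(** * Orbit spaces *)

Section GroupAction.
Context {H : Type} {X : topologicalType} (G : set H) (act : H -> X -> X).

(* The group laws that make the orbits of [G] an equivalence relation; [H] itself
   carries no group structure. *)
Definition group_like :=
  [/\ exists2 e, G e & forall x, act e x = x,
      forall s t, G s -> G t -> exists2 u, G u & forall x, act s (act t x) = act u x &
      forall t, G t -> exists2 u, G u & forall x, act u (act t x) = x].

Hypothesis Ggrp : group_like.

Lemma orbit_eqP (x y : X) :
  \pi_(orbit_space G act) x = \pi_(orbit_space G act) y <-> exists2 t, G t & act t x = y.
Proof.
have [[e Ge eE] GM GV] := Ggrp.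
split=> [/tquot_eqP|xy]; last by apply/tquot_eqP; exact: rst_step.
elim=> {x y} [//|x|x y _ [t Gt <-]|x y z _ [s Gs <-] _ [t Gt <-]].
- by exists e.
- by have [u Gu uE] := GV t Gt; exists u.
- by have [u Gu uE] := GM t s Gt Gs; exists u.
Qed.

(** The saturation of an open set is the union of its preimages under the elements of [G]. *)
Lemma open_map_orbit : (forall t, G t -> continuous (act t)) ->
  open_map (\pi_(orbit_space G act) : X -> orbit_space G act).
Proof.
move=> cact U oU; rewrite /open/= /quotient_open.
rewrite (_ : _ @^-1` _ = \bigcup_(t in G) (act t @^-1` U)).
  apply: bigcup_open => t /cact/continuousP; exact.
apply/seteqP; split=> [y [x Ux /esym/orbit_eqP[t Gt tx]]|y [t Gt Uy]].
  by exists t => //=; rewrite tx.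
by exists (act t y) => //; apply/esym/orbit_eqP; exists t.
Qed.

End GroupAction.

(** * Complex coordinates and cones *)

Section Complex.
Context {R : realType}.
Implicit Types (z w : Cplx R) (s : R).

(** The norm of [Cplx R] takes values in [R[i]]; this is the same number as an element of [R]. *)
Definition modulus z : R := complex.Re `|z|.

Definition sc s z : Cplx R := s%:C * z.

Lemma modulusE z : `|z| = (modulus z)%:C.
Proof. by rewrite /modulus [`|z|]normc_def. Qed.

Lemma modulus_ge0 z : 0 <= modulus z.
Proof. by rewrite -lecR -modulusE; exact: normr_ge0. Qed.

Lemma discE z : disc R z <-> modulus z <= 1.
Proof. by rewrite -lecR -modulusE. Qed.

Lemma circleE z : circle R z <-> modulus z = 1.
Proof.
rewrite /circle /= modulusE; split=> [|->//].
by move=> /(congr1 (@complex.Re R)).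
Qed.

Lemma modulusM z w : modulus (z * w) = modulus z * modulus w.
Proof.
have : `|z * w| = `|z| * `|w| by exact: normrM.
by rewrite !modulusE -rmorphM/= => /(congr1 (@complex.Re R)).
Qed.

Lemma modulus_real s : modulus (s%:C : Cplx R) = `|s|.
Proof. by rewrite /modulus [`|_|]normc_def /= expr0n addr0 sqrtr_sqr. Qed.

Lemma modulus_sc s z : modulus (sc s z) = `|s| * modulus z.
Proof. by rewrite modulusM modulus_real. Qed.

Lemma modulus0 z : modulus z = 0 -> z = 0.
Proof. by move=> z0; apply/eqP; rewrite -normr_eq0 modulusE z0. Qed.

Lemma sc1 z : sc 1 z = z. Proof. by rewrite /sc mul1r. Qed.
Lemma sc0 z : sc 0 z = 0. Proof. by rewrite /sc mul0r. Qed.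
Lemma scA s t z : sc s (sc t z) = sc (s * t) z.
Proof. by rewrite /sc rmorphM /= mulrA. Qed.
Lemma sc_mul s z w : sc s (z * w) = z * sc s w.
Proof. by rewrite /sc mulrCA. Qed.

Lemma sc_inj s : s != 0 -> injective (sc s).
Proof.
move=> s0 z w /(congr1 (sc s^-1)); rewrite !scA mulVf//.
by rewrite !sc1.
Qed.

Lemma continuous_Re : continuous (fun z => complex.Re z : R).
Proof.
move=> z; apply: (cvgrPdist_lt (FF := nbhs_filter z) _ _).2 => e e0.
have e0C : (0 : Cplx R) < e%:C by rewrite ltcR.
apply/nbhs_ballP; exists e%:C => //= w zw.
rewrite -ltcR; apply: le_lt_trans zw.
by have := normc_ge_Re (z - w : R[i]); rewrite raddfB.
Qed.

Lemma continuous_modulus : continuous modulus.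
Proof.
apply: (@continuous_o _ _ _ (fun z => `|z|) (fun z => complex.Re z : R)).
  exact: norm_continuous.
exact: continuous_Re.
Qed.

Lemma continuous_real_complex : continuous (fun s => s%:C : Cplx R).
Proof.
move=> s; apply: (cvgrPdist_lt (FF := nbhs_filter s) _ _).2 => e.
(* A positive element of [R[i]] is real. *)
rewrite ltcE /= => /andP[/eqP ime ree].
apply/nbhs_ballP; exists (complex.Re e) => //= t st.
rewrite -raddfB modulusE modulus_real ltcE /= ime eqxx /=.
exact: st.
Qed.

Lemma continuous_sc (X : topologicalType) (f : X -> R) (g : X -> Cplx R) :
  continuous f -> continuous g -> continuous (fun x => sc (f x) (g x)).
Proof.
move=> cf cg x; apply: cvgM; last exact: cg.
by apply: (continuous_o cf); exact: continuous_real_complex.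
Qed.

Lemma continuous_mulc (X : topologicalType) (t : Cplx R) (g : X -> Cplx R) :
  continuous g -> continuous (fun x => t * g x).
Proof. by move=> cg x; apply: cvgM; [exact: cvg_cst|exact: cg]. Qed.

(** The disc is a closed subset of the image of the square [[-1, 1]^2]. *)
Lemma compact_disc : compact (disc R).
Proof.
pose f (a : R * R) : Cplx R := a.1%:C + 'i * a.2%:C.
have cf : continuous f.
  have c1 : continuous (fun a : R * R => a.1%:C : Cplx R).
    by apply: (continuous_o (@continuous_fst R R)); exact: continuous_real_complex.
  have c2 : continuous (fun a : R * R => 'i * a.2%:C : Cplx R).
    apply: continuous_mulc.
    by apply: (continuous_o (@continuous_snd R R)); exact: continuous_real_complex.
  by move=> a; apply: cvgD; [exact: c1|exact: c2].
have cI := @segment_compact R (-1) 1.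
have cim := continuous_compact (continuous_subspaceT cf) (compact_setX cI cI).
apply: (subclosed_compact _ cim).
  rewrite (_ : disc R = modulus @^-1` [set s | s <= 1]); last first.
    by apply/seteqP; split=> z /discE.
  exact: (iffLR (continuous_closedP modulus) continuous_modulus _ (@closed_le R 1)).
move=> z /discE z1; exists (complex.Re z, complex.Im z).
  have sq : complex.Re z ^+ 2 + complex.Im z ^+ 2 = modulus z ^+ 2.
    by rewrite /modulus [`|z|]normc_def /= sqr_sqrtr// addr_ge0// sqr_ge0.
  have := modulus_ge0 z; split; rewrite /= in_itv /=; apply/andP; split; nra.
by rewrite /f /=; apply/esym; exact: complexE.
Qed.

Lemma compact_circle : compact (circle R).
Proof.
apply: (subclosed_compact _ compact_disc) => [|z]; last exact: circle_disc.
rewrite (_ : circle R = modulus @^-1` [set 1]); last first.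
  by apply/seteqP; split=> z /circleE.
exact: (iffLR (continuous_closedP modulus) continuous_modulus _ (@closed_eq R 1)).
Qed.

Lemma compact_moment_angle (V : finType) (K : {set {set V}}) :
  compact (moment_angle R K).
Proof.
by apply: compact_polyhedral_product => _; [exact: compact_disc|exact: compact_circle].
Qed.

Lemma hausdorff_Cplx : hausdorff_space (Cplx R).
Proof. exact: norm_hausdorff. Qed.

End Complex.

(** * Cones on subsets of complex space *)

Section Cone.
Context {R : realType}.

Lemma compact_unit_interval : compact [set: unit_interval R].
Proof. by apply: compact_set_type; exact: segment_compact. Qed.

Lemma unit_interval_bounds (s : unit_interval R) : 0 <= val s <= 1.
Proof. by have := set_valP s; rewrite /unit_interval/= in_itv. Qed.

Lemma cone_eqP (X : topologicalType) (a b : X * unit_interval R) :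
  \pi_(cone R X) a = \pi_(cone R X) b <-> a = b \/ (val a.2 = 1 /\ val b.2 = 1).
Proof.
split=> [/tquot_eqP|[->//|ab]]; last by apply/tquot_eqP; exact: rst_step.
elim=> {a b} [a b|a|a b _ [->|[]]|a b c _ ab _ bc]; [by right|by left|by left|by right|].
by case: ab bc => [->//|[a1 b1]] [<-|[_ c1]]; right.
Qed.

Context {V : finType} (A : set (prod_topology (fun _ : V => Cplx R))).

Local Notation ambient := (prod_topology (fun _ : V => Cplx R)).

Definition scv (s : R) (x : ambient) : ambient := fun v => sc s (x v).

(* Identifies the cone on [A] with a subset of [C^V x R], where the cone point has
   coordinates [(0, 1)]. *)
Definition shrink (a : A * unit_interval R) : ambient * R :=
  (scv (1 - val a.2) (val a.1), val a.2).

Definition cone_embedding (c : cone R A) : ambient * R := shrink (repr c).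

Lemma cone_embeddingE a : cone_embedding (\pi_(cone R A) a) = shrink a.
Proof.
rewrite /cone_embedding; set b := repr _.
have /cone_eqP[->//|] : \pi_(cone R A) b = \pi_(cone R A) a by rewrite reprK.
rewrite /shrink => -[-> ->].
by congr (_, _); apply/funext => v; rewrite /scv subrr !sc0.
Qed.

(** At level 1 there is only the cone point; below it the factor [1 - s] can be divided out. *)
Lemma cone_embedding_inj : injective cone_embedding.
Proof.
move=> c c'; have [a ->] := tquot_surj c; have [b ->] := tquot_surj c'.
rewrite !cone_embeddingE /shrink => -[/(congr1 (fun f : ambient => f)) xy st].
apply/cone_eqP; have [s1|s1] := eqVneq (val a.2) 1.
  by right; split=> //; exact: (etrans (esym st) s1).
left; case: a b xy st s1 => [x s] [y t] /= xy /val_inj st s1; congr (_, _) => //.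
apply/val_inj/funext => v; move: xy => /(congr1 (fun f : ambient => f v)).
by rewrite /scv -st; apply: sc_inj; rewrite subr_eq0 eq_sym.
Qed.

Lemma continuous_scv (X : topologicalType) (f : X -> R) (g : X -> ambient) :
  continuous f -> continuous g -> continuous (fun x => scv (f x) (g x)).
Proof.
move=> cf cg; apply: continuous_prod => v; apply: continuous_sc => //.
exact: (continuous_o cg (@continuous_proj V (fun=> Cplx R) v)).
Qed.

Lemma continuous_level (X : topologicalType) :
  continuous (fun a : X * unit_interval R => val a.2).
Proof. apply: continuous_o (@continuous_val _ _); exact: continuous_snd. Qed.

Lemma continuous_onem : continuous (fun s : R => 1 - s).
Proof. by move=> s; apply: cvgB; [exact: cvg_cst|exact: cvg_id]. Qed.

Lemma continuous_cone_embedding : continuous cone_embedding.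
Proof.
apply: (quotient_map_factor (quotient_map_pi (@cone_rel R A)) _ cone_embeddingE).
apply: continuous_pair; last exact: continuous_level.
apply: continuous_scv; first exact: (continuous_o (@continuous_level _) continuous_onem).
by apply: (continuous_o (@continuous_fst _ _)); exact: continuous_val.
Qed.

Lemma hausdorff_ambient : hausdorff_space ambient.
Proof. by apply: hausdorff_prod => _; exact: hausdorff_Cplx. Qed.

Lemma hausdorff_cone : hausdorff_space (cone R A).
Proof.
apply: (hausdorff_inj continuous_cone_embedding cone_embedding_inj).
exact: hausdorff_pair hausdorff_ambient (@Rhausdorff R).
Qed.

Lemma continuous_lift (X Y Z : topologicalType) (e : Y -> Z) (h : X -> Y) :
  compact [set: Y] -> hausdorff_space Z -> continuous e -> injective e ->
  continuous (e \o h) -> continuous h.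
Proof.
move=> cY hZ ce ei ceh; apply/continuous_closedP => C cC.
have -> : h @^-1` C = (e \o h) @^-1` (e @` C).
  apply/seteqP; split=> [x Cx|x [y Cy /ei yx]]; first by exists (h x).
  by rewrite /= -yx.
apply: (iffLR (continuous_closedP _) ceh).
apply: compact_closed => //; apply: continuous_compact; first exact: continuous_subspaceT.
exact: subclosed_compact cY _.
Qed.

Lemma compact_cone (X : topologicalType) : compact [set: X] -> compact [set: cone R X].
Proof.
move=> cX; have cXI := compact_setX cX compact_unit_interval.
have := continuous_compact
  (continuous_subspaceT (quotient_map_continuous (quotient_map_pi (@cone_rel R X)))) cXI.
congr compact; apply/seteqP; split=> // c _.
by have [a ->] := tquot_surj c; exists a.
Qed.

End Cone.

(** * The quotient of the product with the polytope *)

Section TorusAction.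
Context {R : realType} {n m : nat} (L : 'M[int]_(n, m)).

Definition circle_mul (s t : circle R) : circle R :=
  elt (circle_act_circle s (set_valP t)).

Lemma circle_inv_subproof (t : circle R) : circle R (val t)^-1.
Proof. by rewrite /circle /= normfV circle_norm invr1. Qed.

Definition circle_inv (t : circle R) : circle R := elt (circle_inv_subproof t).

Lemma circle_mulV t : circle_mul (circle_inv t) t = circle1 R.
Proof.
by apply: val_inj; rewrite /= /circle_act /= mulVf// -normr_eq0 circle_norm oner_eq0.
Qed.

Lemma torus_group_like (Y : topologicalType) (act : torus R m -> Y -> Y) :
  (forall x, act (torus1 R m) x = x) ->
  (forall s t x, act s (act t x) = act (fun i => circle_mul (s i) (t i)) x) ->
  group_like (torus_ker L) act.
Proof.
move=> act1 actM; split.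
- by exists (torus1 R m) => // k; rewrite big1// => i _; exact: exp1rz.
- move=> s t Ls Lt; exists (fun i => circle_mul (s i) (t i)) => // k.
  under eq_bigr do rewrite /= /circle_act /= expfzMl.
  by rewrite big_split /= Ls Lt mulr1.
- move=> t Lt; exists (fun i => circle_inv (t i)) => [k|x].
    under eq_bigr do rewrite /= exprz_inv -invr_expz.
    by rewrite prodfV Lt invr1.
  rewrite actM; have -> : (fun i => circle_mul (circle_inv (t i)) (t i)) = torus1 R m.
    by apply/funext => i; exact: circle_mulV.
  exact: act1.
Qed.

End TorusAction.

Lemma tquot_equivP (X : topologicalType) (r : X -> X -> Prop) (x y : X) :
  (forall x, r x x) -> (forall x y, r x y -> r y x) ->
  (forall x y z, r x y -> r y z -> r x z) ->
  \pi_(tquot r) x = \pi_(tquot r) y <-> r x y.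
Proof.
move=> rr rs rt; split=> [/tquot_eqP|xy]; last by apply/tquot_eqP; exact: rst_step.
by elim=> [//|//|{}x {}y _ /rs//|a b c _ ab _ bc]; exact: rt ab bc.
Qed.

Lemma continuous_min_over (R : realType) (X : topologicalType) (I : finType)
    (u : X -> I -> R) (s : {set I}) :
  (forall i, continuous (fun x => u x i)) -> continuous (fun x => min_over (u x) s).
Proof.
move=> cu; rewrite /min_over; apply: continuous_big => [|i _]; last exact: cu.
exact: min_continuous.
Qed.

Lemma continuous_psi (R : realType) (X : topologicalType) (d m : nat)
    (gamma : {set 'I_m} -> 'rV[R]_d) (u : X -> 'I_m -> R) :
  (forall i, continuous (fun x => u x i)) -> continuous (fun x => psi gamma (u x)).
Proof.
move=> cu; rewrite /psi; apply: continuous_big => [|s _]; first exact: add_continuous.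
by move=> x; apply: cvgZr_tmp; exact: continuous_min_over.
Qed.

Section Sim2.
Context {R : realType} {d n m : nat} (P : set 'rV[R]_d)
  (F : 'I_m -> set 'rV[R]_d) (L : 'M[int]_(n, m)).
Context (X : 'I_m -> topologicalType) (act : forall i, circle R -> X i -> X i).
Hypotheses (hP : simple_polytope F P n)
  (compactX : forall i, compact [set: X i])
  (hausdorffX : forall i, hausdorff_space (X i))
  (hausdorffCX : forall i, hausdorff_space (cone R (X i)))
  (act1 : forall i x, act (i := i) (circle1 R) x = x)
  (actM : forall i s t x, act (i := i) s (act t x) = act (circle_mul s t) x)
  (cact : forall i t, continuous (act (i := i) t)).

Local Notation KP := (dual_complex F P).

Lemma cone_map_pi i (t : circle R) (a : X i * unit_interval R) :
  cone_map (act t) (\pi_(cone R (X i)) a) = \pi_(cone R (X i)) (act t a.1, a.2).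
Proof. exact: tquot_mapE. Qed.

Lemma full_product_group_like : group_like (torus_ker L) (full_product_act act).
Proof.
apply: torus_group_like => [x|s t x]; apply: functional_extensionality_dep => i.
  exact: act1.
exact: actM.
Qed.

Lemma sub_product_group_like (I : {set 'I_m}) :
  group_like (torus_ker L) (@sub_product_act R m X act I).
Proof.
apply: torus_group_like => [x|s t x]; apply: functional_extensionality_dep => i.
  exact: act1.
exact: actM.
Qed.

Lemma cone_product_group_like :
  group_like (torus_ker L) (cone_product_act (P := P) (F := F) act).
Proof.
apply: torus_group_like => [x|s t x]; apply: val_inj;
  apply: functional_extensionality_dep => i /=.
  by have [a ->] := tquot_surj (val x i); rewrite cone_map_pi act1 -surjective_pairing.
have [a ->] := tquot_surj (val x i).
rewrite (cone_map_pi (t i) a) (cone_map_pi (s i) (act (t i) a.1, a.2)) /= actM.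
exact/esym/cone_map_pi.
Qed.

Lemma continuous_full_product_act t : continuous (full_product_act act t).
Proof.
apply: continuous_prod => i.
by apply: (continuous_o (@continuous_proj _ X i)); exact: cact.
Qed.

(** A point consists of an arbitrary point of the product of the [X i] and a point [levels] of the
    cubical complex, so it maps to the polytope side as well as to the cones. *)
Definition cylinder_product :=
  polyhedral_product (E := fun i => (X i * unit_interval R)%type) KP
    (fun=> setT) (fun i => [set a | val a.2 = 0]).

Definition levels (y : cylinder_product) (i : 'I_m) : R := val (val y i).2.

Lemma levels_cube y : cube P F (levels y).
Proof.
split=> [i|]; first exact: unit_interval_bounds.
have [s sK ys] := set_valP y; apply: dual_complex_sub sK.
apply/fintype.subsetP => i; rewrite inE; apply: contraR => si.
by have := ys i; rewrite (negPf si) /= => yi; apply/eqP.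
Qed.

Lemma compact_cylinder_product : compact [set: cylinder_product].
Proof.
have cXI i : compact [set: X i * unit_interval R].
  have := compact_setX (@compactX i) (@compact_unit_interval R).
  by rewrite setXTT.
apply: compact_set_type; apply: compact_polyhedral_product => // i.
apply: (subclosed_compact _ (cXI i)) => //.
exact: (iffLR (continuous_closedP _) (@continuous_level R (X i)) _ (@closed_eq R 0)).
Qed.

Lemma continuous_coordinate i : continuous (fun y : cylinder_product => val y i).
Proof.
exact: (continuous_o (@continuous_val _ cylinder_product)
  (@continuous_proj _ (fun i => (X i * unit_interval R)%type) i)).
Qed.

Lemma continuous_levels i : continuous (fun y => levels y i).
Proof.
exact: (continuous_o (@continuous_coordinate i) (@continuous_level R (X i))).
Qed.

Definition base_point (y : cylinder_product) : full_product X := fun i => (val y i).1.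

Lemma continuous_base_point : continuous base_point.
Proof.
apply: continuous_prod => i.
exact: (continuous_o (@continuous_coordinate i) (@continuous_fst (X i) (unit_interval R))).
Qed.

Lemma cone_product_pi (y : cylinder_product) :
  cone_product (X := X) P F (fun i => \pi_(cone R (X i)) (val y i)).
Proof.
have [s sK ys] := set_valP y; exists s => // i.
by have := ys i; case: ifP => // _ yi; exists (val y i).
Qed.

Lemma quotient_map_cone_product :
  quotient_map (fun y => elt (cone_product_pi y) : cone_product (X := X) P F).
Proof.
apply: quotient_map_closed compact_cylinder_product _ _ _.
- by apply: hausdorff_set_type; apply: hausdorff_prod.
- apply: continuous_set_type => /=; apply: continuous_prod => i.
  apply: (continuous_o (@continuous_coordinate i)); exact: pi_continuous.
- move=> c; have [s sK cs] := set_valP c.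
  (* Outside [s] the representative must be taken at level 0. *)
  have /(_ _)/cid a i : exists a : X i * unit_interval R,
      val c i = \pi_(cone R (X i)) a /\ (i \notin s -> val a.2 = 0).
    have := cs i; case: ifP => _; last by move=> [a a0 ->]; exists a.
    by have [a ->] := tquot_surj (val c i); exists a.
  have ys : cylinder_product (fun i => sval (a i)).
    exists s => // i; move: (sval (a i)) (svalP (a i)) => w [_ w0].
    by case: ifPn => // si; exact: w0.
  exists (elt ys); apply: val_inj; apply: functional_extensionality_dep => i /=.
  exact: (esym (svalP (a i)).1).
Qed.

Lemma sim2_homeomorphic :
  homeomorphic (sim2_space P F L act) (cone_product_quotient P F L act).
Proof.
have [gamma [psi_in psi_inj psi_surj]] := simple_polytope_cube hP.
pose p (y : cylinder_product) : P := elt (psi_in _ (levels_cube y)).1.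
have pE y : facets_at F (val (p y)) = tops (levels y).
  by have [_] := psi_in _ (levels_cube y).
pose f1 (y : cylinder_product) : full_product X * P := (base_point y, p y).
have qf1 : quotient_map f1.
  apply: quotient_map_closed compact_cylinder_product _ _ _.
  - apply: hausdorff_pair; first exact: hausdorff_prod.
    by apply: hausdorff_set_type; exact: norm_hausdorff.
  - apply: continuous_pair; first exact: continuous_base_point.
    by apply: continuous_set_type => /=; apply: continuous_psi; exact: continuous_levels.
  - move=> [w q]; have [u cu uq] := psi_surj _ (set_valP q).
    have [u01 uK] := cu.
    have uI i : unit_interval R (u i) by rewrite /unit_interval /= in_itv; exact: u01.
    have ys : cylinder_product (fun i => (w i, elt (uI i))).
      exists [set i | u i != 0]%SET => // i; rewrite inE.
      by case: eqP.
    exists (elt ys); congr (_, _); apply: val_inj => /=.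
    by rewrite -uq.
pose f2 (a : full_product X * P) : full_quotient L act * P :=
  (\pi_(full_quotient L act) a.1, a.2).
(* Orbit maps are open, so the product with [P] is still a quotient map. *)
have qf2 : quotient_map f2.
  apply: quotient_map_prodl.
  - apply: open_map_orbit full_product_group_like _ => t _.
    exact: continuous_full_product_act.
  - exact: pi_continuous.
  - by move=> a; have [x ->] := tquot_surj a; exists x.
pose f3 : full_quotient L act * P -> sim2_space P F L act := \pi_(sim2_space P F L act).
have qf3 : quotient_map f3 by exact: quotient_map_pi.
have qg := quotient_map_comp quotient_map_cone_product
  (quotient_map_pi (fun x y : cone_product (X := X) P F =>
     exists2 t, torus_ker L t & cone_product_act act t x = y)).
apply: quotient_map_homeomorphic (quotient_map_comp (quotient_map_comp qf1 qf2) qf3) qg _.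
move=> y y' /=.
have simP a b : f3 a = f3 b <-> sim2 F (L := L) (act := act) a b.
  apply: tquot_equivP => [//|[a1 p1] [b1 p2] [/= <- e]|].
    by split=> //=; rewrite e.
  move=> [a1 p1] [b1 p2] [c1 p3] [/= <- e] [/= <- e'].
  by split=> //=; rewrite e.
(* Fibres on the polytope side: the same point of [P], and base points related by one kernel element
   in the coordinates of level different from 1, which are the facets missing that point. *)
have -> : (f3 \o (f2 \o f1)) y = (f3 \o (f2 \o f1)) y' <->
    p y = p y' /\ exists2 t, torus_ker L t &
      forall i, levels y i != 1 -> act (t i) (base_point y i) = base_point y' i.
  rewrite /= simP /sim2 /f2 /f1 /=; split=> -[py]; rewrite !proj_quotientE.
    move=> /(orbit_eqP (sub_product_group_like _))[t Lt tE]; split=> //; exists t => // i i1.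
    have iI : i \in ~: facets_at F (val (p y)) by rewrite finset.in_setC pE inE.
    by have := congr1 (fun f => f (exist _ i iI)) tE.
  move=> [t Lt tE]; split=> //; apply/(orbit_eqP (sub_product_group_like _)).
  exists t => //; apply: functional_extensionality_dep => -[i iI].
  have yi : levels y i != 1 by move: iI; rewrite finset.in_setC pE inE.
  exact: tE.
rewrite (orbit_eqP cone_product_group_like).
(* On the cone side a coordinate of level 1 is the cone point and puts no condition on the base
   point. *)
have coneE t : cone_product_act act t (elt (cone_product_pi y)) = elt (cone_product_pi y') <->
    forall i, (act (t i) (base_point y i), (val y i).2) = val y' i \/
      (levels y i = 1 /\ levels y' i = 1).
  split=> [/(congr1 val)/= E i|E].
    have := congr1 (fun f => f i) E; rewrite /= cone_map_pi.
    by move/cone_eqP.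
  apply: val_inj; apply: functional_extensionality_dep => i /=.
  by rewrite cone_map_pi; apply/cone_eqP; exact: E.
split=> [[py [t Lt tE]]|[t Lt /coneE tE]].
  have yy' : levels y = levels y'.
    by apply: psi_inj; [exact: levels_cube|exact: levels_cube|exact: (congr1 val py)].
  exists t => //; apply/coneE => i.
  have [y1|y1] := eqVneq (levels y i) 1; first by right; rewrite -yy'.
  left; rewrite tE// [RHS]surjective_pairing; congr (_, _).
  by apply: val_inj; exact: (congr1 (fun f => f i) yy').
have yy' : levels y = levels y'.
  apply/funext => i; have [E|[-> ->]//] := tE i.
  by rewrite /levels -E.
split; first by apply: val_inj; rewrite /= yy'.
exists t => // i y1; have [E|[]] := tE i; last by move=> y1'; rewrite y1' eqxx in y1.
by rewrite /base_point -E.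
Qed.

End Sim2.

(** * Retracting polydiscs onto cones *)

(** An equivariant homotopy descends to the orbits. It stays continuous because orbit maps are open,
    so that their product with the interval is a quotient map. *)
Lemma orbit_space_homotopy_equivalent (R : realType) (H : Type) (X Y : topologicalType)
    (G : set H) (actX : H -> X -> X) (actY : H -> Y -> Y) (f : X -> Y) (g : Y -> X)
    (h : Y * unit_interval R -> Y) :
  group_like G actY -> (forall t, G t -> continuous (actY t)) ->
  continuous f -> continuous g -> continuous h -> cancel f g ->
  (forall y s, val s = 0 -> h (y, s) = f (g y)) -> (forall y s, val s = 1 -> h (y, s) = y) ->
  (forall t x, f (actX t x) = actY t (f x)) ->
  (forall t y, g (actY t y) = actX t (g y)) ->
  (forall t y s, h (actY t y, s) = actY t (h (y, s))) ->
  homotopy_equivalent R (orbit_space G actX) (orbit_space G actY).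
Proof.
move=> grpY cact cf cg ch fg h0 h1 fact gact hact.
pose rX (x y : X) := exists2 t, G t & actX t x = y.
pose rY (x y : Y) := exists2 t, G t & actY t x = y.
have rf x y : rX x y -> rY (f x) (f y) by move=> [t Gt <-]; exists t.
have rg x y : rY x y -> rX (g x) (g y) by move=> [t Gt <-]; exists t.
exists (@tquot_map X Y rX rY f), (@tquot_map Y X rY rX g); split.
- exact: tquot_map_continuous.
- exact: tquot_map_continuous.
(* As [g] is a left inverse of [f], the constant homotopy serves. *)
- exists fst; split=> [|a s _|//]; first exact: continuous_fst.
  by have [x ->] := tquot_surj a; rewrite /= (tquot_mapE rf) (tquot_mapE rg) fg.
pose hq (a : tquot rY * unit_interval R) : tquot rY :=
  \pi_(tquot rY) (h (repr a.1, a.2)).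
have hqE y s : hq (\pi_(tquot rY) y, s) = \pi_(tquot rY) (h (y, s)).
  (* The chosen representative differs from [y] by an element of [G], which equivariance of [h]
     absorbs. *)
  have /(orbit_eqP grpY)[t Gt ty] :
      \pi_(orbit_space G actY) (repr (\pi_(tquot rY) y)) = \pi_(orbit_space G actY) y.
    by rewrite reprK.
  by apply/(orbit_eqP grpY); exists t => //=; rewrite -hact ty.
exists hq; split=> [|a s s0|a s s1].
- have qq : quotient_map (fun a : Y * unit_interval R => (\pi_(tquot rY) a.1, a.2)).
    apply: quotient_map_prodl; first exact: open_map_orbit.
      exact: pi_continuous.
    by move=> a; have [y ->] := tquot_surj a; exists y.
  apply: (quotient_map_factor qq (continuous_o ch (@pi_continuous _ _))) => -[y s].
  exact: hqE.
- by have [y ->] := tquot_surj a; rewrite hqE h0// /= (tquot_mapE rg) (tquot_mapE rf).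
- by have [y ->] := tquot_surj a; rewrite hqE h1.
Qed.

(** The critical points are those where the maximum vanishes: there [z] is 0 and, since the scalar
    stays in [[0, 1]], nearby values are bounded by the modulus of [z]. *)
Lemma continuous_clip (R : realType) (X : topologicalType) (theta : X -> R)
    (z : X -> Cplx R) : continuous theta -> continuous z -> (forall x, 0 <= theta x) ->
  continuous (fun x => sc (theta x / Num.max (theta x) (modulus (z x))) (z x)).
Proof.
move=> ct cz t0 x.
have cm : continuous (fun x => Num.max (theta x) (modulus (z x))).
  exact: (continuous_o (continuous_pair ct (continuous_o cz (@continuous_modulus R)))
    (@max_continuous _ R)).
have [m0|m0] := eqVneq (Num.max (theta x) (modulus (z x))) 0.
  have z0 : z x = 0.
    apply: modulus0; apply/le_anti; rewrite modulus_ge0 andbT -m0.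
    by rewrite le_max lexx orbT.
  apply: (cvgrPdist_lt (FF := nbhs_filter x) _ _).2 => e e0.
  have := (cvgrPdist_lt (FF := nbhs_filter x) _ _).1 (cz x) e e0.
  apply: filterS => y; rewrite z0 !sub0r /sc mulr0 !sub0r !normrN => ye.
  apply: le_lt_trans ye; rewrite !modulusE lecR modulus_sc.
  rewrite ler_piMl ?modulus_ge0// ger0_norm; last first.
    by rewrite divr_ge0// le_max t0.
  (* Division by 0 gives 0, which respects the bound. *)
  have [->|M0] := eqVneq (Num.max (theta y) (modulus (z y))) 0.
    by rewrite invr0 mulr0 ler01.
  have Mpos : 0 < Num.max (theta y) (modulus (z y)).
    by rewrite lt_neqAle eq_sym M0 le_max t0.
  by rewrite ler_pdivrMr// mul1r le_max lexx.
have c1 : (fun x => theta x / Num.max (theta x) (modulus (z x))) @ x -->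
    theta x / Num.max (theta x) (modulus (z x)).
  by apply: cvgM; [exact: ct|apply: cvgV => //; exact: cm].
apply: cvgM; last exact: cz.
by apply: (cvg_comp _ _ c1); exact: continuous_real_complex.
Qed.

Section Retraction.
Context {R : realType} {V : finType} (K : {set {set V}}).
Hypotheses (K0 : simplicial_complex K) (KT : [set: V]%SET \notin K).

Local Notation ambient := (prod_topology (fun _ : V => Cplx R)).
Local Notation X := (moment_angle R K).
Implicit Types (z : ambient) (t : circle R).

(** For [0 < r <= 1] the depth is at least [r] exactly when the [v] with [modulus (z v) < r] form a
    simplex. The default 1 caps it. *)
Definition depth z : R :=
  \big[Num.min/1]_(s : {set V} | s \notin K) \big[Num.max/0]_(v in s) modulus (z v).

Lemma depth_le z (s : {set V}) : s \notin K ->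
  depth z <= \big[Num.max/0]_(v in s) modulus (z v).
Proof. by move=> sK; rewrite /depth (bigD1 s)//= ge_min lexx. Qed.

Lemma depth_ge0 z : 0 <= depth z.
Proof.
rewrite /depth; elim/big_rec: _ => [//|s x _ x0].
rewrite le_min x0 andbT; elim/big_rec: _ => // v y _ y0.
by rewrite le_max y0 orbT.
Qed.

Lemma depth_le1 z : depth z <= 1.
Proof. by rewrite /depth; elim/big_rec: _ => // s x _ x1; rewrite ge_min x1 orbT. Qed.

Lemma continuous_depth : continuous depth.
Proof.
apply: continuous_big => [|s _]; first exact: min_continuous.
apply: continuous_big => [|v _]; first exact: max_continuous.
exact: (continuous_o (@continuous_proj V (fun=> Cplx R) v) (@continuous_modulus R)).
Qed.

Lemma modulus_circle t (w : Cplx R) : modulus (circle_act t w) = modulus w.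
Proof.
by rewrite /circle_act modulusM (iffLR (circleE _) (circle_norm t)) mul1r.
Qed.

Lemma depth_diag t z : depth (diag_act t z) = depth z.
Proof.
rewrite /depth; apply: eq_bigr => s _; apply: eq_bigr => v _.
exact: modulus_circle.
Qed.

(** Every nonface has some [v] outside the simplex of [z], where [z v] has modulus 1, the largest
    possible; so after scaling each inner maximum is [s]. *)
Lemma depth_shrink (s : R) z : 0 <= s <= 1 -> X z -> depth (scv s z) = s.
Proof.
move=> /andP[s0 s1] [r /= rK zr].
have z1 v : modulus (z v) <= 1.
  by apply/discE; have := zr v; case: ifP => // _; exact: circle_disc.
have maxE (u : {set V}) : u \notin K ->
    \big[Num.max/0]_(v in u) modulus (scv s z v) = s.
  move=> uK; have /fintype.subsetPn[v vu vr] : ~~ (u \subset r).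
    by apply: contra uK => ur; exact: K0.2 ur rK.
  have modE w : modulus (scv s z w) = s * modulus (z w).
    by rewrite modulus_sc ger0_norm.
  apply/le_anti/andP; split.
    elim/big_rec: _ => // w y _ ys; rewrite ge_max ys andbT modE.
    by rewrite ler_piMr.
  rewrite (bigD1 v)//= le_max modE; have := zr v; rewrite (negPf vr).
  by move=> /circleE ->; rewrite mulr1 lexx.
(* By [KT] the full vertex set is a nonface, so the minimum runs over a nonempty family and equals
   [s] instead of the default 1. *)
rewrite /depth (eq_bigr (fun=> s) maxE) (bigD1 [set: V]%SET)//=.
apply/le_anti/andP; split; first by rewrite ge_min lexx.
by rewrite le_min lexx /=; elim/big_rec: _ => // u y _ sy; rewrite le_min lexx.
Qed.

(* The point [depth z * r z], where [r z] is the radial retraction to [Z(K)] given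
   by [r z v = z v / max (depth z) |z v|]. It makes sense even where [depth z = 0]
   and [r] is undefined: there the scalar is [0], including [0 / 0 = 0]. *)
Definition clip z : ambient :=
  fun v => sc (depth z / Num.max (depth z) (modulus (z v))) (z v).

Lemma continuous_clip_depth : continuous clip.
Proof.
apply: continuous_prod => v; apply: continuous_clip.
- exact: continuous_depth.
- exact: continuous_proj.
- exact: depth_ge0.
Qed.

Lemma clip_diag t z : clip (diag_act t z) = diag_act t (clip z).
Proof.
apply/funext => v; rewrite /clip depth_diag [X in modulus X]/diag_act modulus_circle.
exact: sc_mul.
Qed.

Lemma clip_shrink (s : R) z : 0 <= s <= 1 -> X z -> clip (scv s z) = scv s z.
Proof.
move=> s01 Xz; apply/funext => v; rewrite /clip depth_shrink//.
have /andP[s0 s1] := s01.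
have [->|sn0] := eqVneq s 0; first by rewrite mul0r sc0 /scv sc0.
have z1 : modulus (z v) <= 1.
  by have [r _ zr] := Xz; apply/discE; have := zr v; case: ifP => // _; exact: circle_disc.
have -> : Num.max s (modulus (scv s z v)) = s.
  by rewrite modulus_sc ger0_norm//; apply/max_idPl; rewrite ler_piMr.
by rewrite divff// sc1.
Qed.

Lemma scv1 z : scv 1 z = z.
Proof. by apply/funext => v; exact: sc1. Qed.

Lemma depth_moment_angle z : X z -> depth z = 1.
Proof. by move=> Xz; rewrite -{1}(scv1 z) depth_shrink// ler01 lexx. Qed.

Lemma clip_moment_angle z : X z -> clip z = z.
Proof. by move=> Xz; rewrite -{1}(scv1 z) clip_shrink ?scv1// ler01 lexx. Qed.

Lemma clip_polydisc z : polydisc R V z -> polydisc R V (clip z).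
Proof.
move=> z1 v; apply/discE; rewrite modulus_sc.
have z1v : modulus (z v) <= 1 by apply/discE; exact: z1.
have m0 := modulus_ge0 (z v); have d0 := depth_ge0 z.
have [M0|M0] := eqVneq (Num.max (depth z) (modulus (z v))) 0.
  by rewrite M0 invr0 mulr0 normr0 mul0r ler01.
have Mpos : 0 < Num.max (depth z) (modulus (z v)) by rewrite lt_neqAle eq_sym M0 le_max d0.
have q0 : 0 <= depth z / Num.max (depth z) (modulus (z v)) by rewrite divr_ge0// ltW.
have q1 : depth z / Num.max (depth z) (modulus (z v)) <= 1.
  by rewrite ler_pdivrMr// mul1r le_max lexx.
by rewrite ger0_norm// mulr_ile1.
Qed.

(** For positive depth the base point is the radial retraction [r] of [z]. It lies in the
    moment-angle complex because the coordinates of modulus below the depth form a simplex. *)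
Lemma exists_retract z : exists c : cone R X, cone_embedding c = (clip z, 1 - depth z).
Proof.
have levelP : unit_interval R (1 - depth z).
  by rewrite /unit_interval /= in_itv /= subr_ge0 depth_le1 gerBl depth_ge0.
suff [x xE] : exists x : X, scv (depth z) (val x) = clip z.
  exists (\pi_(cone R X) (x, elt levelP)); rewrite cone_embeddingE /shrink /=.
  by rewrite subKr xE.
(* At depth 0 the level is 1, so any base point represents the cone point. *)
have [d0|d0] := eqVneq (depth z) 0.
  have X1 : X (fun=> 1).
    by exists finset.set0 => [|v]; [exact: K0.1|rewrite inE; exact: circle_unit].
  by exists (elt X1); apply/funext => v; rewrite /scv /clip d0 mul0r !sc0.
have dpos : 0 < depth z by rewrite lt_neqAle eq_sym d0 depth_ge0.
pose r : ambient := fun v => sc (Num.max (depth z) (modulus (z v)))^-1 (z v).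
have Mpos v : 0 < Num.max (depth z) (modulus (z v)) by rewrite lt_max dpos.
have rmod v : modulus (r v) = modulus (z v) / Num.max (depth z) (modulus (z v)).
  by rewrite modulus_sc ger0_norm 1?mulrC// invr_ge0 ltW.
have Xr : X r.
  (* Were this set a nonface, its largest modulus would be at least the depth; it is smaller, even
     for the empty set, as the depth is positive. *)
  exists [set v | modulus (z v) < depth z]%SET => /= [|v].
    apply/negPn/negP => /(depth_le z); rewrite leNgt => /negP; apply.
    elim/big_rec: _ => // v y; rewrite inE => zv yd.
    by rewrite gt_max zv.
  rewrite inE; case: ifPn => zv.
    by apply/discE; rewrite rmod ler_pdivrMr// mul1r le_max lexx orbT.
  apply/circleE; rewrite rmod; rewrite -leNgt in zv.
  by rewrite (max_idPr zv) divff// gt_eqF// (lt_le_trans dpos).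
exists (elt Xr); apply/funext => v.
by rewrite /clip /= /scv /r scA.
Qed.

Definition retract z : cone R X := sval (cid (exists_retract z)).

Lemma retractE z : cone_embedding (retract z) = (clip z, 1 - depth z).
Proof. by rewrite /retract; case: cid. Qed.

(** [retract] is obtained by choice, so continuity is read off from its composite with the embedding
    of the cone. *)
Lemma continuous_retract : continuous retract.
Proof.
apply: (@continuous_lift _ _ _ (@cone_embedding R V X)).
- apply: compact_cone; apply: compact_set_type; exact: compact_moment_angle.
- exact: hausdorff_pair (@hausdorff_ambient R V) (@Rhausdorff R).
- exact: continuous_cone_embedding.
- exact: cone_embedding_inj.
have -> : @cone_embedding R V X \o retract = fun z => (clip z, 1 - depth z).
  by apply/funext => z; exact: retractE.
apply: continuous_pair; first exact: continuous_clip_depth.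
exact: (continuous_o continuous_depth (@continuous_onem R)).
Qed.

Definition cone_to_disc (c : cone R X) : ambient := (cone_embedding c).1.

Lemma continuous_cone_to_disc : continuous cone_to_disc.
Proof. exact: (continuous_o (@continuous_cone_embedding R V X) (@continuous_fst _ _)). Qed.

Lemma cone_to_disc_pi (a : X * unit_interval R) :
  cone_to_disc (\pi_(cone R X) a) = scv (1 - val a.2) (val a.1).
Proof. by rewrite /cone_to_disc cone_embeddingE. Qed.

Lemma colevel_bounds (s : unit_interval R) : 0 <= 1 - val s <= 1.
Proof. by have /andP[s0 s1] := unit_interval_bounds s; rewrite subr_ge0 s1 gerBl. Qed.

Lemma cone_to_discK : cancel cone_to_disc retract.
Proof.
move=> c; apply: (@cone_embedding_inj R V X); rewrite retractE.
have [a ->] := tquot_surj c; rewrite cone_to_disc_pi cone_embeddingE /shrink.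
have Xa := set_valP a.1; have a01 := colevel_bounds a.2.
by rewrite clip_shrink// depth_shrink// subKr.
Qed.

Lemma retractK z : cone_to_disc (retract z) = clip z.
Proof. by rewrite /cone_to_disc retractE. Qed.

Lemma cone_to_disc_polydisc c : polydisc R V (cone_to_disc c).
Proof.
have [a ->] := tquot_surj c => v; rewrite cone_to_disc_pi; apply/discE.
rewrite modulus_sc; have /andP[s0 s1] := colevel_bounds a.2.
rewrite ger0_norm// mulr_ile1 ?modulus_ge0//; apply/discE.
by have [r _ ar] := set_valP a.1; have := ar v; case: ifP => // _; exact: circle_disc.
Qed.

Lemma cone_to_disc_base c : cone_base c -> X (cone_to_disc c).
Proof.
by move=> [a a0 ->]; rewrite cone_to_disc_pi a0 subr0 scv1; exact: set_valP.
Qed.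

Lemma retract_base z : X z -> cone_base (retract z).
Proof.
move=> Xz; have u0 : unit_interval R 0 by rewrite /unit_interval /= in_itv /= lexx ler01.
exists (elt Xz, elt u0) => //; apply: (@cone_embedding_inj R V X).
rewrite retractE clip_moment_angle// depth_moment_angle// cone_embeddingE /shrink /=.
by rewrite subrr subr0 scv1.
Qed.

Lemma scv_diag t (s : R) z : scv s (diag_act t z) = diag_act t (scv s z).
Proof. by apply/funext => v; exact: sc_mul. Qed.

Lemma cone_to_disc_diag t c :
  cone_to_disc (cone_map (moment_angle_diag (K := K) t) c) = diag_act t (cone_to_disc c).
Proof.
have [a ->] := tquot_surj c.
have -> : cone_map (moment_angle_diag (K := K) t) (\pi_(cone R X) a) =
    \pi_(cone R X) (moment_angle_diag t a.1, a.2) by exact: tquot_mapE.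
by rewrite !cone_to_disc_pi -scv_diag.
Qed.

Lemma retract_diag t z :
  retract (diag_act t z) = cone_map (moment_angle_diag (K := K) t) (retract z).
Proof.
apply: (@cone_embedding_inj R V X); rewrite retractE clip_diag depth_diag.
have := retractE z; have [a ->] := tquot_surj (retract z).
have -> : cone_map (moment_angle_diag (K := K) t) (\pi_(cone R X) a) =
    \pi_(cone R X) (moment_angle_diag t a.1, a.2) by exact: tquot_mapE.
rewrite !cone_embeddingE /shrink /= => -[<- <-].
by rewrite -scv_diag.
Qed.

Definition slide (z : ambient) (s : R) : ambient :=
  fun v => sc (1 - s) (clip z v) + sc s (z v).

Lemma slide0 z : slide z 0 = clip z.
Proof. by apply/funext => v; rewrite /slide subr0 sc1 sc0 addr0. Qed.

Lemma slide1 z : slide z 1 = z.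
Proof. by apply/funext => v; rewrite /slide subrr sc0 sc1 add0r. Qed.

Lemma slide_diag t z s : slide (diag_act t z) s = diag_act t (slide z s).
Proof.
apply/funext => v; rewrite /slide clip_diag /diag_act /circle_act !sc_mul.
by rewrite -mulrDr.
Qed.

(** [clip] fixes the moment-angle complex, so the homotopy does too; this keeps it inside the
    polyhedral product at indices outside the simplex. *)
Lemma slide_moment_angle z s : X z -> slide z s = z.
Proof.
move=> Xz; apply/funext => v; rewrite /slide clip_moment_angle// /sc -mulrDl -rmorphD /=.
by rewrite subrK mul1r.
Qed.

Lemma slide_polydisc z s : 0 <= s <= 1 -> polydisc R V z -> polydisc R V (slide z s).
Proof.
move=> /andP[s0 s1] z1 v.
have cv : modulus (clip z v) <= 1 by apply/discE; exact: clip_polydisc.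
rewrite /disc /slide /=; move: (clip z v) cv => w cv.
have zv : modulus (z v) <= 1 by apply/discE; exact: z1.
apply: le_trans (ler_normD _ _) _; rewrite !modulusE -rmorphD lecR !modulus_sc.
have s1' : 0 <= 1 - s by rewrite subr_ge0.
rewrite !ger0_norm//; have := ler_piMr s0 zv; have := ler_piMr s1' cv.
by lra.
Qed.

Lemma continuous_slide (Y : topologicalType) (f : Y -> ambient) (u : Y -> R) :
  continuous f -> continuous u -> continuous (fun y => slide (f y) (u y)).
Proof.
move=> cf cu; apply: continuous_prod => v.
have cp := @continuous_proj V (fun=> Cplx R) v.
have c1 : continuous (fun y => sc (1 - u y) (clip (f y) v)).
  apply: continuous_sc; first exact: (continuous_o cu (@continuous_onem R)).
  exact: (continuous_o (continuous_o cf continuous_clip_depth) cp).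
have c2 : continuous (fun y => sc (u y) (f y v)).
  by apply: continuous_sc; [exact: cu|exact: (continuous_o cf cp)].
by move=> y; apply: cvgD; [exact: c1|exact: c2].
Qed.

End Retraction.

(** If all vertices formed a simplex, the origin would lie in the moment-angle complex and be fixed
    by [-1]. *)
Lemma free_not_full (R : realType) (V : finType) (K : {set {set V}}) :
  acts_freely (circle1 R) setT (moment_angle_diag (K := K)) -> [set: V]%SET \notin K.
Proof.
move=> hfree; apply/negP => KT.
have X0 : moment_angle R K (fun=> 0).
  by exists [set: V]%SET => // v; rewrite inE /disc /= normr0 ler01.
have cN1 : circle R (- 1) by rewrite /circle /= normrN normr1.
have /(congr1 val)/= : elt cN1 = circle1 R.
  apply: (hfree _ (elt X0) I); apply: val_inj; apply/funext => v /=.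
  by rewrite /circle_act mulr0.
by move/eqP; rewrite eq_sym -subr_eq0 opprK -[1 + 1]/(2%:R) pnatr_eq0.
Qed.

(** * Homotopy equivalence of the two polyhedral products *)

Section DiscProduct.
Context {R : realType} {d n m : nat} (P : set 'rV[R]_d) (F : 'I_m -> set 'rV[R]_d)
  (L : 'M[int]_(n, m)) (j : 'I_m -> nat) (K : forall i : 'I_m, {set {set 'I_(j i)}}).
Hypotheses (hK : forall i, simplicial_complex (K i))
  (hfree : forall i, acts_freely (circle1 R) setT (moment_angle_diag (K := K i))).

Local Notation X := (fun i : 'I_m => moment_angle R (K i) : topologicalType).
Local Notation rot := (fun i : 'I_m => moment_angle_diag (K := K i)).
Local Notation ambient i := (prod_topology (fun _ : 'I_(j i) => Cplx R)).

Lemma moment_angle_diag1 i (x : moment_angle R (K i)) :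
  moment_angle_diag (circle1 R) x = x.
Proof. by apply: val_inj; apply/funext => v /=; rewrite /circle_act mul1r. Qed.

Lemma moment_angle_diagM i s t (x : moment_angle R (K i)) :
  moment_angle_diag s (moment_angle_diag t x) = moment_angle_diag (circle_mul s t) x.
Proof. by apply: val_inj; apply/funext => v /=; rewrite /circle_act mulrA. Qed.

Lemma continuous_diag_act (V : finType) (t : circle R) :
  continuous (@diag_act R V t).
Proof.
by apply: continuous_prod => v; apply: continuous_mulc; exact: continuous_proj.
Qed.

Lemma continuous_moment_angle_diag i (t : circle R) :
  continuous (moment_angle_diag (K := K i) t).
Proof.
apply: continuous_set_type.
exact: (continuous_o (@continuous_val _ _) (@continuous_diag_act _ t)).
Qed.

Lemma disc_product_group_like :
  group_like (torus_ker L) (disc_product_act (P := P) (F := F) (K := K)).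
Proof.
apply: torus_group_like => [x|s t x]; apply: val_inj;
  apply: functional_extensionality_dep => i; apply/funext => v /=.
  by rewrite /diag_act /circle_act mul1r.
by rewrite /diag_act /circle_act mulrA.
Qed.

Lemma continuous_disc_coordinate i :
  continuous (fun x : disc_product P F K => val x i : ambient i).
Proof.
exact: (continuous_o (@continuous_val _ _) (@continuous_proj _ (fun i => ambient i) i)).
Qed.

Lemma continuous_disc_product_act t :
  continuous (disc_product_act (P := P) (F := F) (K := K) t).
Proof.
apply: continuous_set_type; apply: continuous_prod => i.
exact: (continuous_o (@continuous_disc_coordinate i) (@continuous_diag_act _ (t i))).
Qed.

Lemma to_disc_product (c : cone_product (X := X) P F) :
  disc_product P F K (fun i => cone_to_disc (val c i)).
Proof.
have [s sK cs] := set_valP c; exists s => // i; have := cs i.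
case: ifP => _ ci; [exact: cone_to_disc_polydisc|exact: cone_to_disc_base].
Qed.

Lemma to_cone_product (x : disc_product P F K) :
  cone_product (X := X) P F (fun i => retract (hK i) (val x i)).
Proof.
have [s sK xs] := set_valP x; exists s => // i; have := xs i.
by case: ifP => // _; apply: retract_base; exact: free_not_full.
Qed.

Lemma slide_disc_product (a : disc_product P F K * unit_interval R) :
  disc_product P F K (fun i => slide (K i) (val a.1 i) (val a.2)).
Proof.
have [s sK xs] := set_valP a.1; exists s => // i; have := xs i.
case: ifP => _ xi; first by apply: slide_polydisc => //; exact: unit_interval_bounds.
by rewrite slide_moment_angle//; exact: free_not_full.
Qed.

Lemma cone_disc_homotopy_equivalent :
  homotopy_equivalent R (cone_product_quotient P F L rot) (disc_product_quotient P F L K).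
Proof.
pose f (c : cone_product (X := X) P F) : disc_product P F K := elt (to_disc_product c).
pose g (x : disc_product P F K) : cone_product (X := X) P F := elt (to_cone_product x).
pose h (a : disc_product P F K * unit_interval R) : disc_product P F K :=
  elt (slide_disc_product a).
have := @orbit_space_homotopy_equivalent R (torus R m) (cone_product (X := X) P F)
  (disc_product P F K) (torus_ker L) (cone_product_act rot)
  (@disc_product_act R d m P F j K) f g h.
apply.
- exact: disc_product_group_like.
- by move=> t _; exact: continuous_disc_product_act.
- apply: continuous_set_type; apply: continuous_prod => i.
  have cc : continuous (fun c : cone_product (X := X) P F => val c i).
    exact: (continuous_o (@continuous_val _ _) (@continuous_proj _ (fun i => cone R (X i)) i)).
  exact: (continuous_o cc (@continuous_cone_to_disc R _ (K i))).
- apply: continuous_set_type; apply: continuous_prod => i.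
  exact: (continuous_o (@continuous_disc_coordinate i) (@continuous_retract R _ (K i) (hK i))).
- apply: continuous_set_type; apply: continuous_prod => i; apply: continuous_slide.
    exact: (continuous_o (@continuous_fst _ _) (@continuous_disc_coordinate i)).
  exact: continuous_level.
- move=> c; apply: val_inj; apply: functional_extensionality_dep => i /=.
  exact: (cone_to_discK (hK i) (free_not_full (@hfree i))).
- move=> x s s0; apply: val_inj; apply: functional_extensionality_dep => i /=.
  by rewrite s0 slide0 retractK.
- move=> x s s1; apply: val_inj; apply: functional_extensionality_dep => i /=.
  by rewrite s1 slide1.
- move=> t c; apply: val_inj; apply: functional_extensionality_dep => i /=.
  exact: cone_to_disc_diag.
- move=> t x; apply: val_inj; apply: functional_extensionality_dep => i /=.
  exact: retract_diag.
- move=> t x s; apply: val_inj; apply: functional_extensionality_dep => i /=.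
  exact: slide_diag.
Qed.

End DiscProduct.

Theorem theorem6p4 (R : realType) (d n m : nat)
    (P : set 'rV[R]_d) (F : 'I_m -> set 'rV[R]_d) (L : 'M[int]_(n, m))
    (j : 'I_m -> nat) (K : forall i : 'I_m, {set {set 'I_(j i)}})
    (hP : simple_polytope F P n)
    (hL : characteristic_function P F L)
    (hK : forall i, simplicial_complex (K i))
    (hfree : forall i,
       acts_freely (circle1 R) setT (moment_angle_diag (K := K i))) :
  let X i : topologicalType := moment_angle R (K i) in
  let rot i : circle R -> X i -> X i := moment_angle_diag (K := K i) in
  [/\ acts_freely (torus1 R m) (torus_ker L)
        (composed_moment_angle_act (P := P) (F := F) (K := K)),
      homeomorphic (sim2_space P F L rot) (cone_product_quotient P F L rot),
      homotopy_equivalent R (cone_product_quotient P F L rot)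
        (disc_product_quotient P F L K) &
      homeomorphic (disc_product_quotient P F L K)
        (composed_moment_angle_quotient P F L K)].
Proof.
move=> X rot; split.
- exact: composed_action_free hP hL hfree.
- apply: (sim2_homeomorphic L hP).
  + by move=> i; apply: compact_set_type; exact: compact_moment_angle.
  + by move=> i; apply: hausdorff_set_type; exact: hausdorff_ambient.
  + by move=> i; exact: hausdorff_cone.
  + exact: moment_angle_diag1.
  + exact: moment_angle_diagM.
  + by move=> i t; exact: continuous_moment_angle_diag.
- exact: cone_disc_homotopy_equivalent hK hfree.
- exact: composed_moment_angle_homeomorphic.
Qed.
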